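(* Let $(G,H)=(\mathrm O(p,q),\mathrm O(p_1,q_1)\times\mathrm O(p-p_1,q-q_1))$ with $0<p_1<p$, $0<q_1<q$, $0\le r\le\min\{p,q\}$, and let $S\in\mathcal O(r_U,r_W,a,b_U,b_W)\subseteq\mathrm{Gr}_G(r)$, with stabilizer $H_S=\{h\in H:h(S)=S\}$. Then $$\dim\mathcal O(r_U,r_W,a,b_U,b_W)=\dim H-\dim H_S=\binom{p_1+q_1}2+\binom{p-p_1+q-q_1}2-\dim H_S,$$ and $\dim H_S$ equals $$\begin{aligned}&\tfrac12\binom{p_1+q_1}2+\tfrac12\binom{p+q-p_1-q_1}2+\frac{r_U^2+r_W^2}2+\binom{b_U+b_W}2-a(b_U+b_W)\\&-\tfrac12\binom{p_1+q_1-2r_U-2a}2-\tfrac12\binom{p+q-p_1-q_1-2r_W-2a}2\\&+\binom{p_1+q_1-2r_U-2a-b_U-b_W}2+\binom{p+q-p_1-q_1-2r_W-2a-b_U-b_W}2.\end{aligned}$$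
   Context: $V=\mathbb R^{p+q}$ has a nondegenerate symmetric bilinear form $B$ of signature $(p,q)$; $V=U\oplus W$ with $U\perp W$, $B|_U$ of signature $(p_1,q_1)$ and $B|_W$ of signature $(p-p_1,q-q_1)$. $G$ is the isometry group of $V$ and $H$ the product of the isometry groups of $U$ and $W$. $\mathrm{Gr}_G(r)$ is the variety of $r$-dimensional subspaces $S$ of $V$ with $S\perp S$. Dimensions of groups and orbits are real dimensions. $\binom k2=k(k-1)/2$. For a subspace $X$, $\mathrm{Rad}(X)=X\cap X^\perp$; $\mathbf P_US=(S+W)\cap U$, $\mathbf P_WS=(S+U)\cap W$. For $S\in\mathrm{Gr}_G(r)$: $r_U(S)=\dim(S\cap U)$, $r_W(S)=\dim(S\cap W)$, $a(S)=\dim\frac{\mathrm{Rad}(\mathbf P_US)}{S\cap U}=\dim\frac{\mathrm{Rad}(\mathbf P_WS)}{S\cap W}$, and $b_U(S)$ (resp. $b_W(S)$) is the dimension of a maximal positive definite (resp. negative definite) subspace of $\mathbf P_US$. The 5-tuple $(r_U(S),r_W(S),a(S),b_U(S),b_W(S))$ determines the $H$-orbit of $S$; $\mathcal O(r_U,r_W,a,b_U,b_W)$ denotes the $H$-orbit with this 5-tuple. *)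

(* Defs.v *)
From HB Require Import structures.
From mathcomp Require Import all_boot all_order all_algebra.
From mathcomp Require Import all_classical all_reals all_analysis.

Set Implicit Arguments.
Unset Strict Implicit.
Unset Printing Implicit Defensive.

Import Order.TTheory GRing.Theory Num.Theory numFieldNormedType.Exports.
Local Open Scope classical_set_scope.
Local Open Scope ring_scope.

(* Vectors are row vectors, a subspace of R^n is the row space of a matrix
   (equality of subspaces is (_ == _)%MS), a bilinear form is its Gram matrix
   B, i.e. B(v, w) = v *m B *m w^T, and a linear map g acts by v |-> v *m g. *)

Section Forms.
Variables (R : realType) (n : nat) (B : 'M[R]_n).
Implicit Types X Y D S g : 'M[R]_n.

Definition perp X Y := X *m B *m Y^T = 0.

Definition orthc X : 'M[R]_n := kermx (B *m X^T).

Definition Rad X : 'M[R]_n := (X :&: orthc X)%MS.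

Definition posdef X := forall v : 'rV[R]_n,
  (v <= X)%MS -> v != 0 -> 0 < (v *m B *m v^T) 0 0.

Definition negdef X := forall v : 'rV[R]_n,
  (v <= X)%MS -> v != 0 -> (v *m B *m v^T) 0 0 < 0.

Definition pos_index X : nat := (\max_(k < n.+1 |
  `[< exists D, [/\ (D <= X)%MS, posdef D & \rank D = k] >]) k)%N.

Definition neg_index X : nat := (\max_(k < n.+1 |
  `[< exists D, [/\ (D <= X)%MS, negdef D & \rank D = k] >]) k)%N.

(* The restriction of B to X is nondegenerate of signature (p, q). *)
Definition has_signature X (p q : nat) := exists P N : 'M[R]_n,
  [/\ posdef P /\ \rank P = p, negdef N /\ \rank N = q,
      perp P N & (P + N == X)%MS].

Definition is_isometry g := g \in unitmx /\ g *m B *m g^T = B.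

End Forms.

Section Orbits.
Variables (R : realType) (n : nat) (B U W : 'M[R]_n).
Implicit Types S P h : 'M[R]_n.

Definition projU S : 'M[R]_n := ((S + W) :&: U)%MS.

(* (r_U, r_W, a, b_U, b_W); when S is totally isotropic, S :&: U is contained
   in Rad (projU S), so that the third entry is the dimension of the quotient.
   Both indices are taken on projU S. *)
Definition invariants S : nat * nat * nat * nat * nat :=
  (\rank (S :&: U)%MS,
   \rank (S :&: W)%MS,
   (\rank (Rad B (projU S)) - \rank (S :&: U)%MS)%N,
   pos_index B (projU S),
   neg_index B (projU S)).

(* The product of the isometry groups of U and W, inside the isometry group of
   R^n = U (+) W. *)
Definition Hgroup : set 'M[R]_n :=
  [set h | is_isometry B h /\ (U *m h == U)%MS /\ (W *m h == W)%MS].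

Definition Hstab S : set 'M[R]_n :=
  [set h | Hgroup h /\ (S *m h == S)%MS].

(* The points of the Grassmannian are taken in the usual embedding of the
   Grassmannian in the space of n x n matrices: a subspace is identified with
   the matrix of the orthogonal projection, for the standard inner product of
   R^n, onto that subspace. This is the unique symmetric idempotent matrix with
   the given row space. *)
Definition grassmannian (r : nat) : set 'M[R]_n :=
  [set P | P^T = P /\ P *m P = P /\ \rank P = r].

Definition Gr (r : nat) : set 'M[R]_n :=
  [set P | grassmannian r P /\ perp B P P].

Definition Horbit (r : nat) S : set 'M[R]_n :=
  [set P | grassmannian r P /\ exists2 h, Hgroup h & (P == S *m h)%MS].

(* O is an H-orbit in Gr r and t is its 5-tuple. *)
Definition Horbit_of_type (r : nat) (t : nat * nat * nat * nat * nat)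
    (O : set 'M[R]_n) :=
  exists S, [/\ Gr r S, invariants S = t & O = Horbit r S].

End Orbits.

Section Dimension.
Variables (R : realType) (m n : nat).

Definition C1_immersion_on (e : nat) (Omega : set 'rV[R]_e)
    (phi : 'rV[R]_e -> 'M[R]_(m, n)) :=
  forall u, Omega u ->
    [/\ differentiable phi u,
        forall v, {for u, continuous (fun x => 'd phi x v)} &
        injective ('d phi u)].

Definition contains_C1_piece (M : set 'M[R]_(m, n)) (e : nat) :=
  exists (Omega : set 'rV[R]_e) (phi : 'rV[R]_e -> 'M[R]_(m, n)),
    [/\ open Omega, Omega !=set0, C1_immersion_on Omega phi &
        phi @` Omega `<=` M].

(* Real dimension: the largest e such that M contains the image of a C^1
   immersion of a nonempty open subset of R^e. An immersion into a space of
   m x n matrices has e <= m * n, so bounding e loses nothing. For a (possibly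
   only immersed, second countable) submanifold this is the dimension of the
   manifold, and for a semialgebraic set it is its semialgebraic dimension. *)
Definition real_dim (M : set 'M[R]_(m, n)) : nat :=
  (\max_(e < (m * n).+1 | `[< contains_C1_piece M e >]) e)%N.

End Dimension.

(* No truncation: the argument is a rational number. *)
Definition binom2 (k : rat) : rat := k * (k - 1) / 2.

(* Main.v *)
Require Import Defs.
From HB Require Import structures.
From mathcomp Require Import all_boot all_order all_algebra.
From mathcomp Require Import all_classical all_reals all_analysis.
From mathcomp Require Import ring lra zify.

Set Implicit Arguments.
Unset Strict Implicit.
Unset Printing Implicit Defensive.

Import Order.TTheory GRing.Theory Num.Theory numFieldNormedType.Exports.
Local Open Scope classical_set_scope.
Local Open Scope ring_scope.

(** Write e for the projection of V onto U along W. The stabilizer of S in H is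
    an algebraic group: differentiating its equations shows that an immersed
    piece has at most the dimension of the Lie algebra h_S, and the Cayley
    transform X |-> (1 - X) (1 + X)^-1 = 2 (1 + X)^-1 - 1 provides a piece of
    that dimension. Applying the Cayley transform to a complement of h_S in h
    shows dim h - dim h_S <= dim O.

    Conversely, a tangent vector of O at the orthogonal projection P onto S is
    a symmetric matrix Q which induces T : S -> V / S and satisfies linear
    equations, because S stays isotropic and because P e, P (1 - e) and the Gram
    matrix P e B P^T have constant rank along O. In a basis of V adapted to S
    these equations leave at most t parameters free, and those of h_S at most F,
    where F is the announced formula and F + t = dim h. Hence
      dim h - F <= dim h - dim h_S <= dim O <= t = dim h - F,
    so that both upper bounds are attained. *)

(** * Limits and differentials of matrix-valued maps *)

Section MatrixLimits.
Variable R : realType.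

(** An immersed piece of O does not lift to H without a further argument, so dim O <= dim h - dim
    h_S is not read off the orbit map. This is why the tangent vectors of O are counted
    independently of h_S. Both counts are only upper bounds: the unknown matrix is cut into blocks,
    and each block costs at most its number of free entries. The identity F + t = dim h then forces
    equality everywhere, so neither the elements of h_S nor the tangent vectors of O have to be
    parametrized. What must be found is a sufficient list of equations. A signature cannot be
    differentiated but a constant rank can, and b = b_U + b_W is the rank of the form on P_U S; rank
    conditions therefore carry all five invariants as far as dimensions are concerned. The number u
    - 2 r_U - 2 a - b in the formula, with u = dim U, is the dimension of a complement of Rad (P_U
    S) in the orthogonal of P_U S inside U. *)

Lemma cvg_mx (T : Type) (F : set_system T) {FF : Filter F} m n
    (f : T -> 'M[R]_(m, n)) (l : 'M[R]_(m, n)) :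
  (forall i j, f x i j @[x --> F] --> l i j) -> f @ F --> l.
Proof.
move=> fl A [P Pl PA].
have : \forall x \near F, forall i j, P i j (f x i j).
  by apply: filter_forall => i; apply: filter_forall => j; exact: fl.
by apply: filterS => x /PA.
Qed.

Lemma cvg_entry (T : Type) (F : set_system T) {FF : Filter F} m n
    (f : T -> 'M[R]_(m, n)) (l : 'M[R]_(m, n)) i j :
  f @ F --> l -> f x i j @[x --> F] --> l i j.
Proof.
move=> fl; exact: (cvg_comp f (fun M : 'M[R]_(m, n) => M i j) fl
  (@coord_continuous _ _ _ i j l)).
Qed.

Lemma cvg_mulmx (T : Type) (F : set_system T) {FF : Filter F} m n p
    (f : T -> 'M[R]_(m, n)) (g : T -> 'M[R]_(n, p))
    (A : 'M[R]_(m, n)) (B : 'M[R]_(n, p)) :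
  f @ F --> A -> g @ F --> B -> f x *m g x @[x --> F] --> A *m B.
Proof.
move=> fA gB; apply: cvg_mx => i j; rewrite mxE.
under eq_fun do rewrite mxE.
apply: (cvg_big (op := +%R)) => [|k _]; first exact: add_continuous.
by apply: cvgM; exact: cvg_entry.
Qed.

Lemma cvg_det (T : Type) (F : set_system T) {FF : Filter F} n
    (f : T -> 'M[R]_n) (A : 'M[R]_n) :
  f @ F --> A -> \det (f x) @[x --> F] --> \det A.
Proof.
move=> fA; rewrite /determinant.
apply: (cvg_big (op := +%R)) => [|s _]; first exact: add_continuous.
apply: cvgM; first exact: cvg_cst.
apply: (cvg_big (U := R) (op := *%R)) => [|i _]; first exact: mul_continuous.
exact: cvg_entry.
Qed.

(** Finite dimension is used here: [L (f x)] is a finite combination of the entries of [f x] with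
    fixed coefficients [L (delta_mx i j)]. *)
Lemma cvg_linear_mx (T : Type) (F : set_system T) {FF : Filter F} m n
    (W : normedModType R) (L : {linear 'M[R]_(m, n) -> W})
    (f : T -> 'M[R]_(m, n)) (A : 'M[R]_(m, n)) :
  f @ F --> A -> L (f x) @[x --> F] --> L A.
Proof.
move=> fA.
have LE X : L X = \sum_i \sum_j X i j *: L (delta_mx i j).
  rewrite {1}(matrix_sum_delta X) linear_sum; apply: eq_bigr => i _.
  by rewrite linear_sum; apply: eq_bigr => j _; rewrite linearZ.
rewrite LE; under eq_fun do rewrite LE.
apply: (cvg_big (op := +%R)) => [|i _]; first exact: add_continuous.
apply: (cvg_big (op := +%R)) => [|j _]; first exact: add_continuous.
by apply: cvgZr_tmp; exact: cvg_entry.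
Qed.

Lemma linear_mx_continuous m n (W : normedModType R)
    (L : {linear 'M[R]_(m, n) -> W}) : continuous L.
Proof. by move=> A; exact: (@cvg_linear_mx _ (nbhs A) _ _ _ _ L id A). Qed.

Lemma near_unitmx (T : Type) (F : set_system T) {FF : Filter F} n
    (f : T -> 'M[R]_n) (A : 'M[R]_n) :
  f @ F --> A -> A \in unitmx -> \forall x \near F, f x \in unitmx.
Proof.
move=> fA; rewrite unitmxE unitfE => dA.
have := (cvgrPdist_lt _ _).1 (cvg_det fA) `|\det A|.
rewrite normr_gt0 => /(_ FF FF dA).
apply: filterS => X; rewrite unitmxE unitfE; apply: contraTneq => ->.
by rewrite subr0 ltxx.
Qed.

Lemma cvg_invmx (T : Type) (F : set_system T) {FF : Filter F} n
    (f : T -> 'M[R]_n) (A : 'M[R]_n) :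
  f @ F --> A -> A \in unitmx -> invmx (f x) @[x --> F] --> invmx A.
Proof.
move=> fA uA.
have -> : invmx A = (\det A)^-1 *: \adj A by rewrite /invmx uA.
(* [invmx] is the identity map outside [unitmx], so the adjugate formula is available only near
   [A]. *)
apply: (@cvg_trans _ ((\det (f x))^-1 *: \adj (f x) @[x --> F])).
  refine (near_eq_cvg _); apply: filterS (near_unitmx fA uA) => X.
  by rewrite /invmx => ->.
apply: cvgZ.
  by apply: cvgV; [move: uA; rewrite unitmxE unitfE|exact: cvg_det].
apply: cvg_mx => i j; rewrite mxE /cofactor.
under eq_fun do rewrite mxE /cofactor.
apply: cvgM; first exact: cvg_cst.
apply: cvg_det; apply: cvg_mx => k l; rewrite !mxE.
by under eq_fun do rewrite !mxE; exact: cvg_entry.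
Qed.

End MatrixLimits.

Section MatrixDifferentials.
Variable R : realType.

Lemma is_diff_linear_mx m n (W : normedModType R)
    (L : {linear 'M[R]_(m, n) -> W}) A : is_diff A L L.
Proof.
apply: DiffDef; first exact/linear_differentiable/linear_mx_continuous.
by rewrite diff_lin //; exact: linear_mx_continuous.
Qed.

Lemma mulmx_is_bilinear m n p :
  bilinear_for (GRing.Scale.Law.clone _ _ *:%R _)
    (GRing.Scale.Law.clone _ _ *:%R _) (@mulmx R m n p).
Proof.
split=> [u'|u] a x y /=.
- by rewrite mulmxDl scalemxAl.
- by rewrite mulmxDr scalemxAr.
Qed.

HB.instance Definition _ m n p := bilinear_isBilinear.Build R 'M[R]_(m, n)
  'M[R]_(n, p) 'M[R]_(m, p) _ _ (@mulmx R m n p) (@mulmx_is_bilinear m n p).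

Lemma mulmx_continuous m n p :
  continuous (fun q : 'M[R]_(m, n) * 'M[R]_(n, p) => q.1 *m q.2).
Proof.
move=> q; apply: (@cvg_mulmx R _ (nbhs q)); first exact: cvg_fst.
exact: cvg_snd.
Qed.

Lemma is_diff_mulmx (V : normedModType R) m n p (f df : V -> 'M[R]_(m, n))
    (g dg : V -> 'M[R]_(n, p)) x :
  is_diff x f df -> is_diff x g dg ->
  is_diff x (fun y => f y *m g y) (fun v => df v *m g x + f x *m dg v).
Proof.
move=> fx gx.
have mc := @mulmx_continuous m n p.
have mq q : is_diff q (fun q : 'M[R]_(m, n) * 'M[R]_(n, p) => q.1 *m q.2)
    (fun r => q.1 *m r.2 + r.1 *m q.2).
  apply: DiffDef; first exact: (@differentiable_bilin R _ _ _ (@mulmx R m n p)).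
  exact: (@diff_bilin R _ _ _ (@mulmx R m n p)).
apply: (@is_diff_eq _ _ _ _ _ _ _ (is_diff_comp (is_diff_pair fx gx) (mq _))).
by apply/funext => v /=; rewrite addrC.
Qed.

Lemma is_diff_remainder (V W : normedModType R) (f : V -> W)
    (df : {linear V -> W}) x : continuous df ->
  (forall e, 0 < e ->
    \forall h \near (0 : V), `|f (h + x) - f x - df h| <= e * `|h|) ->
  is_diff x f df.
Proof.
move=> dfc fx.
have H : f \o shift x = cst (f x) + df +o_ 0 id.
  apply/eqaddoP => e e0; apply: filterS (fx e e0) => h.
  by rewrite !fctE /= opprD addrA.
have E := diff_unique dfc H.
by apply: DiffDef => //; apply/diff_locallyP; rewrite E.
Qed.

(** The remainder equals A^-1 h (A^-1 - (A + h)^-1), which is o(h) because inversion is already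
    known to be continuous at [A]. *)
Lemma is_diff_invmx n (A : 'M[R]_n) : A \in unitmx ->
  is_diff A invmx (fun H => - (invmx A *m H *m invmx A)).
Proof.
move=> uA.
pose L H := - (invmx A *m H *m invmx A).
have lL : linear L.
  move=> a X Y; rewrite /L mulmxDr mulmxDl opprD -scalemxAr -scalemxAl scalerN.
  by [].
pose LM := GRing.isLinear.Build _ _ _ _ _ lL.
pose LL : {linear _ -> _} := HB.pack L LM.
have [_ /posnumP[k1] mk] :=
  bilinear_schwarz (f := @mulmx R n n n) (@mulmx_continuous n n n).
apply: (@is_diff_remainder _ _ _ LL); first exact: linear_mx_continuous.
move=> e e0.
have cA : h + A @[h --> (0 : 'M[R]_n)] --> A.
  rewrite -[X in _ --> X]add0r; 
  apply: (@cvgD _ _ _ (nbhs (0 : 'M[R]_n)) _ id (cst A)) => //.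
  exact: cvg_cst.
have near_u := near_unitmx cA uA.
(* [k1] bounds the norm of a product by the product of norms; [d] solves k1 (k1 |A^-1| + 1) d = e,
   where the summand 1 keeps the denominator positive. *)
set d := e / (k1%:num * (k1%:num * `|invmx A| + 1)).
have c1 : 0 < k1%:num * `|invmx A| + 1 by rewrite ltr_wpDl // mulr_ge0.
have d0 : 0 < d by rewrite divr_gt0 // mulr_gt0.
have near_d := (cvgrPdist_le _ _).1 (cvg_invmx cA uA) d d0.
near=> h.
have uX : h + A \in unitmx by near: h; exact: near_u.
have Xd : `|invmx A - invmx (h + A)| <= d by near: h; exact: near_d.
have -> : invmx (h + A) - invmx A - LL h
    = (invmx A *m h) *m (invmx A - invmx (h + A)).
  have E : invmx A *m h *m invmx (h + A) = invmx A - invmx (h + A).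
    rewrite -{1}(addrK A h) mulmxBr mulmxBl mulVmx // mul1mx.
    by rewrite -mulmxA mulmxV // mulmx1.
  by rewrite [RHS]mulmxBr E /= /L opprK opprB [RHS]addrC.
apply: le_trans (mk _ _) _.
apply: (@le_trans _ _ (k1%:num * (k1%:num * `|invmx A| * `|h|) * d)).
  by apply: ler_pM; rewrite ?mulr_ge0 ?ler_pM2l ?mk.
have -> : k1%:num * (k1%:num * `|invmx A| * `|h|) * d =
  (k1%:num * `|invmx A|) * (k1%:num * d) * `|h| by ring.
apply: ler_wpM2r => //.
apply: (@le_trans _ _ ((k1%:num * `|invmx A| + 1) * (k1%:num * d))).
  by rewrite ler_wpM2r ?lerDl // mulr_ge0 // ltW.
rewrite le_eqVlt /d; apply/orP; left; apply/eqP; field.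
by rewrite ?gt_eqF.
Unshelve. all: by end_near. Qed.

End MatrixDifferentials.

(** * C^1 maps given together with their differential *)

Lemma near_eq_continuous (T U : topologicalType) (f g : T -> U) u :
  {near u, f =1 g} -> {for u, continuous g} -> {for u, continuous f}.
Proof.
move=> fg gc; rewrite /prop_for /continuous_at (nbhs_singleton fg).
apply: cvg_trans gc; apply: near_eq_cvg; apply: filterS fg => x; exact: esym.
Qed.

Section ContinuouslyDifferentiable.
Variables (R : realType) (e : nat).
Implicit Types u v : 'rV[R]_e.

(** The source of the equations on tangent vectors: an identity that holds along a piece makes some
    expression locally constant, and the differential of that expression vanishes. *)
Lemma is_diff_near_cst (V W : normedModType R) (f df : V -> W) (x v : V) c :
  is_diff x f df -> (\forall y \near x, f y = c) -> df v = 0.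
Proof.
move=> fx fc.
have fxc : f x = c by exact: nbhs_singleton fc.
have H : is_diff x f (\0 : {linear V -> W}).
  apply: is_diff_remainder => [y|eps eps0]; first apply: (@cvg_cst _ _ _ (nbhs _)).
  move: fc; rewrite (near_shift 0) subr0; apply: filterS => h /= ->.
  by rewrite fxc subrr subr0 normr0 mulr_ge0 // ltW.
by rewrite -(diff_val (f := f) (df := df)) (diff_val (f := f) (df := \0)).
Qed.

(** The differential is an explicit function of the base point, so that its continuity in [x] is
    propagated by the product and inverse rules instead of being proved for ['d f x] afterwards. *)
Definition C1_at m n (f : 'rV[R]_e -> 'M[R]_(m, n))
    (df : 'rV[R]_e -> 'rV[R]_e -> 'M[R]_(m, n)) u :=
  is_diff u f (df u) /\ forall v, df x v @[x --> u] --> df u v.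

Lemma C1_at_continuous m n (f : 'rV[R]_e -> 'M[R]_(m, n)) df u :
  C1_at f df u -> f x @[x --> u] --> f u.
Proof. by case=> fu _; have /differentiable_continuous := @ex_diff _ _ _ _ _ _ _ fu. Qed.

Lemma C1_at_linear m n (L : {linear 'rV[R]_e -> 'M[R]_(m, n)}) u :
  C1_at L (fun=> L) u.
Proof. by split=> [|v]; [exact: is_diff_linear_mx|apply: (@cvg_cst _ _ _ (nbhs _))]. Qed.

Lemma C1_at_cst m n (A : 'M[R]_(m, n)) u : C1_at (fun=> A) (fun _ _ => 0) u.
Proof. by split=> [|v]; [exact: is_diff_cst|apply: (@cvg_cst _ _ _ (nbhs _))]. Qed.

Lemma C1_at_add m n (f g : 'rV[R]_e -> 'M[R]_(m, n)) df dg u :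
  C1_at f df u -> C1_at g dg u ->
  C1_at (fun x => f x + g x) (fun x v => df x v + dg x v) u.
Proof.
move=> [fu fc] [gu gc]; split=> [|v]; first exact: is_diffD.
by apply: (@cvgD _ _ _ (nbhs u)).
Qed.

Lemma C1_at_mulmx m n p (f : 'rV[R]_e -> 'M[R]_(m, n))
    (g : 'rV[R]_e -> 'M[R]_(n, p)) df dg u :
  C1_at f df u -> C1_at g dg u ->
  C1_at (fun x => f x *m g x) (fun x v => df x v *m g x + f x *m dg x v) u.
Proof.
move=> fu gu; have [fd fc] := fu; have [gd gc] := gu.
split=> [|v]; first exact: is_diff_mulmx.
apply: (@cvgD _ _ _ (nbhs u)); apply: (@cvg_mulmx R _ (nbhs u)) => //.
- exact: C1_at_continuous gu.
- exact: C1_at_continuous fu.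
Qed.

Lemma C1_at_trmx m n (f : 'rV[R]_e -> 'M[R]_(m, n)) df u :
  C1_at f df u -> C1_at (fun x => (f x)^T) (fun x v => (df x v)^T) u.
Proof.
move=> [fd fc]; split=> [|v].
  exact: (is_diff_comp fd (is_diff_linear_mx (@trmx R m n) _)).
exact: (@cvg_linear_mx R _ (nbhs u) _ _ _ _ (@trmx R m n) (df^~ v)).
Qed.

Lemma C1_at_invmx n (f : 'rV[R]_e -> 'M[R]_n) df u :
  C1_at f df u -> f u \in unitmx ->
  C1_at (fun x => invmx (f x))
    (fun x v => - (invmx (f x) *m df x v *m invmx (f x))) u.
Proof.
move=> fu uf; have [fd fc] := fu; split=> [|v].
  exact: (is_diff_comp fd (is_diff_invmx uf)).
have ic := @cvg_invmx R _ (nbhs u) _ _ _ _ (C1_at_continuous fu) uf.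
apply: (@cvgN _ _ _ (nbhs u)).
apply: (@cvg_mulmx R _ (nbhs u)); last exact: ic.
apply: (@cvg_mulmx R _ (nbhs u)); [exact: ic|exact: fc].
Qed.

Lemma C1_immersion_onP m n (Omega : set 'rV[R]_e)
    (f : 'rV[R]_e -> 'M[R]_(m, n)) df :
  open Omega -> (forall u, Omega u -> C1_at f df u) ->
  (forall u, Omega u -> injective (df u)) -> C1_immersion_on Omega f.
Proof.
move=> oO fO iO u Ou; have [fd fc] := fO u Ou; split=> [|v|].
- exact: ex_diff.
- apply: (near_eq_continuous (g := fun x => df x v)); last exact: fc.
  apply: filterS (open_nbhs_nbhs (conj oO Ou)) => x Ox.
  by have [[_ xd] _] := fO x Ox; exact: (congr1 (@^~ v) xd).
- by have [_ ->] := fd; exact: iO.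
Qed.

(** Full rank is an open condition: if [N] is a right inverse of the matrix [M u] of [df u], then
    [M x *m N] stays invertible for [x] near [u]. *)
Lemma near_injective m n (df : 'rV[R]_e -> 'rV[R]_e -> 'M[R]_(m, n)) u :
  (forall v, df x v @[x --> u] --> df u v) ->
  (\forall x \near u, linear (df x)) -> (forall v, df u v = 0 -> v = 0) ->
  \forall x \near u, injective (df x).
Proof.
move=> dc dl di.
pose M x : 'M[R]_(e, m * n) := \matrix_i mxvec (df x (delta_mx 0 i)).
have ME x v : linear (df x) -> v *m M x = mxvec (df x v).
  move=> dlx; pose mkLM := GRing.isLinear.Build _ _ _ _ _ dlx.
  pose mkL : {linear _ -> _} := HB.pack (df x) mkLM.
  rewrite {2}(row_sum_delta v) -[df x _]/(mkL _) mulmx_sum_row.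
  rewrite !linear_sum; apply: eq_bigr => i _.
  by rewrite rowK !linearZ.
have /row_freeP[N MN] : row_free (M u).
  apply: inj_row_free => v /eqP; rewrite ME; last exact: nbhs_singleton dl.
  by rewrite mxvec_eq0 => /eqP; exact: di.
have Mc : M x *m N @[x --> u] --> M u *m N.
  apply: (@cvg_mulmx R _ (nbhs u)); last apply: (@cvg_cst _ _ _ (nbhs u)).
  apply: (@cvg_mx R _ (nbhs u)) => i j; rewrite mxE; under eq_fun do rewrite mxE.
  apply: (@cvg_entry R _ (nbhs u)).
  exact: (@cvg_linear_mx R _ (nbhs u) _ _ _ _ mxvec (df^~ (delta_mx 0 i))).
have := @near_unitmx R _ (nbhs u) _ _ _ _ Mc; rewrite MN => /(_ _ (unitmx1 _ _)).
apply: filterS2 dl => x dlx ux v w dvw.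
by apply: (can_inj (mulmxK ux)); rewrite /= !mulmxA !ME // dvw.
Qed.

End ContinuouslyDifferentiable.

(** * Dimension of sets of matrices *)

Section RealDimension.
Variables (R : realType).

Lemma real_dim_le m n (M : set 'M[R]_(m, n)) d :
  (forall e, contains_C1_piece M e -> (e <= d)%N) -> (real_dim M <= d)%N.
Proof. by move=> H; apply/bigmax_leqP => e /asboolP; exact: H. Qed.

Lemma real_dim_ge m n (M : set 'M[R]_(m, n)) d :
  (d <= m * n)%N -> contains_C1_piece M d -> (d <= real_dim M)%N.
Proof.
move=> dmn Md; pose i := @Ordinal (m * n).+1 d dmn.
by apply: (@leq_bigmax_cond _ _ (fun e : 'I_(m * n).+1 => e : nat) i); apply/asboolP.
Qed.

Lemma injective_dimv m n e (L : {vspace 'M[R]_(m, n)})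
    (f : 'rV[R]_e -> 'M[R]_(m, n)) :
  linear f -> injective f -> (forall v, f v \in L) -> (e <= \dim L)%N.
Proof.
move=> fl fi fL.
pose lfM := GRing.isLinear.Build _ _ _ _ _ fl.
pose lf : {linear _ -> _} := HB.pack f lfM.
have := limg_dim_eq (f := linfun lf) (U := fullv).
have -> : (fullv :&: lker (linfun lf))%VS = 0%VS.
  apply/eqP; rewrite -subv0; apply/subvP => v; rewrite memv_cap memv_ker memv0.
  move=> /andP[_]; rewrite lfunE => /eqP v0; apply/eqP/fi.
  transitivity (0 : 'M[R]_(m, n)); first exact: v0.
  by rewrite -[f]/(lf : _ -> _) linear0.
move=> /(_ erefl) dimf.
have fLS : (limg (linfun lf) <= L)%VS.
  by apply/subvP => _ /memv_imgP[v _ ->]; rewrite lfunE; exact: fL.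
by have := dimvS fLS; rewrite dimf dimvf dim_matrix mul1r.
Qed.

(** One point of the piece suffices, since the differential there is injective. The factor [N] moves
    the tangent space to a convenient place: to the Lie algebra for a group, nowhere ([N] = 1) for
    an orbit. *)
Lemma C1_piece_dim_le m n (M : set 'M[R]_(m, n)) e d :
  (forall (f df : 'rV[R]_e -> 'M[R]_(m, n)) u, is_diff u f df ->
    (\forall x \near u, M (f x)) ->
    exists (L : {vspace 'M[R]_(m, n)}) N,
      [/\ N \in unitmx, forall v, df v *m N \in L & (\dim L <= d)%N]) ->
  contains_C1_piece M e -> (e <= d)%N.
Proof.
move=> H [D [phi [oD [u Du] iD DM]]]; have [dphi _ iphi] := iD u Du.
have near_M : \forall x \near u, M (phi x).
  by apply: filterS (open_nbhs_nbhs (conj oD Du)) => x Dx; apply: DM; exists x.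
have [L [N [uN T Ld]]] := H phi ('d phi u) u (differentiableP dphi) near_M.
apply: leq_trans Ld.
apply: (@injective_dimv m n e L (fun v => 'd phi u v *m N)) => //.
- by move=> a x y; rewrite linearP mulmxDl scalemxAl.
- by move=> x y /(can_inj (mulmxK uN)); exact: iphi.
Qed.

(* With R0 and C0 such that R0 (f u) C0 = 1, the Schur complement of R0 f C0 in
   the matrix with blocks R0 f C0, R0 f C, K f C0, K f C vanishes near u, and its
   derivative at u is K (df v) C. *)
Lemma constant_rank_diff e m n k l (f df : 'rV[R]_e -> 'M[R]_(m, n)) u v
    (K : 'M[R]_(k, m)) (C : 'M[R]_(n, l)) :
  is_diff u f df -> (\forall x \near u, \rank (f x) = \rank (f u)) ->
  K *m f u = 0 -> f u *m C = 0 -> K *m df v *m C = 0.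
Proof.
move=> fu fr Kf fC.
have /row_freeP[C0 RC0] := row_base_free (f u).
have /row_fullP[R0 RR0] : row_full (col_base (f u)) by exact: col_base_full.
have a1 : R0 *m f u *m C0 = 1%:M.
  have -> : R0 *m f u = row_base (f u); last exact: RC0.
  transitivity (R0 *m (col_base (f u) *m row_base (f u))).
    by rewrite mulmx_base.
  by rewrite mulmxA RR0 mul1mx.
have fcont := differentiable_continuous (ex_diff (is_diff_def := fu)).
have ac : R0 *m f x *m C0 @[x --> u] --> R0 *m f u *m C0.
  apply: (@cvg_mulmx R _ (nbhs u)); last apply: (@cvg_cst _ _ _ (nbhs u)).
  by apply: (@cvg_mulmx R _ (nbhs u)); first apply: (@cvg_cst _ _ _ (nbhs u)).
have near_a := @near_unitmx R _ (nbhs u) _ _ _ _ ac.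
rewrite a1 unitmx1 in near_a.
have schur : \forall x \near u, K *m f x *m C - (K *m f x *m C0) *m
    invmx (R0 *m f x *m C0) *m (R0 *m f x *m C) = 0.
  near=> x.
  have ux : R0 *m f x *m C0 \in unitmx by near: x; exact: near_a.
  have rx : \rank (f x) = \rank (f u) by near: x.
  have fR : (f x <= R0 *m f x)%MS.
    have [_ /esym] := mxrank_leqif_eq (submxMl R0 (f x)).
    suff -> : \rank (R0 *m f x) == \rank (f x) by case/andP.
    rewrite eqn_leq mxrankM_maxr /= rx -{1}(mxrank_unit ux).
    exact: mxrankM_maxl.
  have /submxP[Y ->] : (K *m f x <= R0 *m f x)%MS.
    exact: submx_trans (submxMl _ _) fR.
  by rewrite -(mulmxA Y _ C0) mulmxK // !mulmxA subrr.
have cd p q (A : 'M[R]_(p, q)) : is_diff u (fun=> A) (fun=> 0) by exact: is_diff_cst.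
have fd p q (A : 'M[R]_(p, m)) (D : 'M[R]_(n, q)) :
    is_diff u (fun x => A *m f x *m D) (fun v => A *m df v *m D).
  apply: is_diff_eq (is_diff_mulmx (is_diff_mulmx (cd _ _ A) fu) (cd _ _ D)) _.
  by apply/funext => w; rewrite mulmx0 addr0 mul0mx add0r.
have ua : R0 *m f u *m C0 \in unitmx by rewrite a1 unitmx1.
have ad := is_diff_comp (fd _ _ R0 C0) (is_diff_invmx ua).
have gd := is_diffB (fd _ _ K C)
  (is_diff_mulmx (is_diff_mulmx (fd _ _ K C0) ad) (fd _ _ R0 C)).
have := is_diff_near_cst v gd schur.
rewrite !fctE /= Kf mul0mx -[R0 *m f u *m C]mulmxA fC !mulmx0 !mul0mx.
by rewrite !addr0 subr0.
Unshelve. all: by end_near. Qed.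

End RealDimension.

(** * Stabilizers and their Lie algebras *)

Section Subspaces.
Variables (K : fieldType) (vT : vectType K).

(** Take a subspace of maximal dimension on which [P] holds; adjoining the line through any solution
    of [P] cannot enlarge it. *)
Lemma vspaceP_exists (P : vT -> Prop) :
  P 0 -> (forall a x y, P x -> P y -> P (a *: x + y)) ->
  exists L : {vspace vT}, forall x, x \in L <-> P x.
Proof.
move=> P0 Plin.
pose Q d := `[< exists2 L : {vspace vT}, (forall x, x \in L -> P x) & \dim L = d >].
have exQ : exists d, Q d.
  exists 0%N; apply/asboolP; exists 0%VS; last by rewrite dimv0.
  by move=> x; rewrite memv0 => /eqP ->.
have ubQ d : Q d -> (d <= \dim {:vT})%N.
  by move=> /asboolP[L _ <-]; exact/dimvS/subvf.
have [d /asboolP[L LP Ld] maxd] := ex_maxnP exQ ubQ.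
exists L => x; split=> [|Px]; first exact: LP.
have /maxd : Q (\dim (<[x]> + L)).
  apply/asboolP; exists (<[x]> + L)%VS => // _ /memv_addP[_ /vlineP[a ->] [y Ly ->]].
  by apply: Plin => //; exact: LP.
rewrite -Ld => dimle.
have /eqP -> : L == (<[x]> + L)%VS by rewrite eqEdim addvSr.
by rewrite memvE; exact: addvSl.
Qed.

Lemma vspace_param (L : {vspace vT}) :
  exists f : {linear 'rV[K]_(\dim L) -> vT},
    injective f /\ forall x, f x \in L.
Proof.
pose f (x : 'rV[K]_(\dim L)) := \sum_i x 0 i *: (vbasis L)`_i.
have fl : linear f.
  move=> a x y; rewrite /f scaler_sumr -big_split; apply: eq_bigr => i _.
  by rewrite !mxE scalerDl scalerA.
pose lfM := GRing.isLinear.Build _ _ _ _ _ fl.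
pose lf : {linear _ -> _} := HB.pack f lfM.
exists lf; split=> [x y fxy|x]; last first.
  by apply: memv_suml => i _; apply/memvZ/vbasis_mem/mem_nth; rewrite size_tuple.
apply/rowP => i; have := congr1 (coord (vbasis L) i) fxy.
by rewrite /= /f !coord_sum_free // (basis_free (vbasisP L)).
Qed.
End Subspaces.

Section Stabilizers.
Variables (R : realType) (n : nat) (B U W : 'M[R]_n).
Implicit Types S X : 'M[R]_n.

(* The Lie algebra of the stabilizer of S in H; S = 0 gives that of H. *)
Definition stab_algebra S X :=
  [/\ X *m B + B *m X^T = 0, (U *m X <= U)%MS, (W *m X <= W)%MS &
      (S *m X <= S)%MS].

Lemma stab_algebra_vspace S :
  exists L : {vspace 'M[R]_n}, forall X, X \in L <-> stab_algebra S X.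
Proof.
apply: vspaceP_exists => [|a X Y [X1 X2 X3 X4] [Y1 Y2 Y3 Y4]].
  by split; rewrite ?mulmx0 ?sub0mx // mul0mx trmx0 mulmx0 addr0.
split; last first.
- by rewrite mulmxDr -scalemxAr addmx_sub // scalemx_sub.
- by rewrite mulmxDr -scalemxAr addmx_sub // scalemx_sub.
- by rewrite mulmxDr -scalemxAr addmx_sub // scalemx_sub.
rewrite linearP /= mulmxDl mulmxDr -scalemxAl -scalemxAr addrACA -scalerDr.
by rewrite X1 Y1 scaler0 addr0.
Qed.

Lemma submx_invmx m (A : 'M[R]_(m, n)) g :
  g \in unitmx -> (A <= A *m g)%MS -> (A *m invmx g <= A)%MS.
Proof. by move=> ug /(submxMr (invmx g)); rewrite mulmxK. Qed.

(** Stability of the row space of [A] is the linear equation A f(x) [cokermx A] = 0, which can be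
    differentiated. *)
Lemma stable_diff e m (A : 'M[R]_(m, n)) (f df : 'rV[R]_e -> 'M[R]_n) u v :
  is_diff u f df -> (\forall x \near u, (A *m f x <= A)%MS) ->
  (A *m df v <= A)%MS.
Proof.
move=> fu Af; have cd p q (D : 'M[R]_(p, q)) :
  is_diff u (fun=> D) (fun=> 0) by exact: is_diff_cst.
have gd := is_diff_mulmx (is_diff_mulmx (cd _ _ A) fu) (cd _ _ (cokermx A)).
have := is_diff_near_cst (c := 0) v gd.
rewrite mulmx0 addr0 mul0mx add0r submxE => ->; first by [].
by apply: filterS Af => x; rewrite submxE => /eqP.
Qed.

Hypothesis uB : B \in unitmx.

(** Right translation by the inverse of [f u] brings the tangent vector to the identity; the
    isometry equation gives (f u)^-1 B = B (f u)^T, which turns the differentiated equation into the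
    skewness of X B. *)
Lemma Hstab_tangent e S (f df : 'rV[R]_e -> 'M[R]_n) u v :
  is_diff u f df -> (\forall x \near u, Hstab B U W S (f x)) ->
  stab_algebra S (df v *m invmx (f u)).
Proof.
move=> fu Hf.
have [[[gu gB] [/andP[_ Ug] /andP[_ Wg]]] /andP[_ Sg]] := nbhs_singleton Hf.
have st (A : 'M[R]_n) : (\forall x \near u, (A *m f x <= A)%MS) ->
    (A <= A *m f u)%MS -> (A *m (df v *m invmx (f u)) <= A)%MS.
  move=> Af Au; rewrite mulmxA; apply: submx_trans (submxMr _ _) (submx_invmx gu Au).
  exact: stable_diff fu Af.
split; last first.
- by apply: st => //; apply: filterS Hf => x [_ /andP[]].
- by apply: st => //; apply: filterS Hf => x [[_ [_ /andP[]]]].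
- by apply: st => //; apply: filterS Hf => x [[_ [/andP[]]]].
have cd : is_diff u (fun=> B) (fun=> 0) by exact: is_diff_cst.
have td := is_diff_comp fu (is_diff_linear_mx (@trmx R n n) _).
have := is_diff_near_cst v (is_diff_mulmx (is_diff_mulmx fu cd) td).
rewrite mulmx0 addr0 /= => /(_ B) E.
have {}E : df v *m B *m (f u)^T + f u *m B *m (df v)^T = 0.
  by apply: E; apply: filterS Hf => x [[[_ ? _] _]].
have XB : df v *m invmx (f u) *m B = df v *m B *m (f u)^T.
  by rewrite -[in LHS]gB !mulmxA mulmxKV.
have BX : B *m (df v *m invmx (f u))^T = f u *m B *m (df v)^T.
  rewrite trmx_mul trmx_inv -{1}gB mulmxA mulmxK ?unitmx_tr //.
by rewrite XB BX.
Qed.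

Lemma isometry_unitmx g : g *m B *m g^T = B -> g \in unitmx.
Proof.
move=> gB; move: uB; rewrite -gB !unitmxE !det_mulmx !unitrM.
by case/andP => /andP[].
Qed.

(** Skewness of X B gives (1 + X) B = B (1 - X)^T and (1 - X) B = B (1 + X)^T, whence g B g^T = B.
    The form 2 (1 + X)^-1 - 1 contains [X] only once, which suits differentiation and stability
    alike. *)
Lemma cayley_Hstab S X : stab_algebra S X -> 1%:M + X \in unitmx ->
  Hstab B U W S (2%:M *m invmx (1%:M + X) - 1%:M).
Proof.
move=> [XB UX WX SX] uX; set Y := invmx (1%:M + X); set g := _ - _.
have gY : g = Y *m (1%:M - X).
  have -> : 1%:M - X = 2%:M - (1%:M + X).
    by rewrite -[2]/(1 + 1) raddfD opprD addrA addrK.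
  by rewrite mulmxBr mulVmx // mul_mx_scalar -mul_scalar_mx.
have gY' : g = (1%:M - X) *m Y.
  have -> : 1%:M - X = 2%:M - (1%:M + X).
    by rewrite -[2]/(1 + 1) raddfD opprD addrA addrK.
  by rewrite mulmxBl mulmxV.
have XB1 : (1%:M + X) *m B = B *m (1%:M - X)^T.
  rewrite linearB /= trmx1 mulmxDl mulmxBr mulmx1 mul1mx; congr (_ + _).
  by apply/eqP; rewrite -addr_eq0 XB.
have XB2 : (1%:M - X) *m B = B *m (1%:M + X)^T.
  rewrite linearD /= trmx1 mulmxBl mulmxDr mulmx1 mul1mx; congr (_ + _).
  by apply/eqP; rewrite eq_sym -addr_eq0 addrC XB.
have gB : g *m B *m g^T = B.
  rewrite {1}gY {1}gY' trmx_mul !mulmxA -(mulmxA Y) XB2 mulmxA.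
  rewrite trmx_inv mulmxK ?unitmx_tr // -mulmxA -XB1 /Y mulKmx //.
have ug := isometry_unitmx gB.
(* [A] is mapped into itself by the invertible 1 + X, hence onto itself by rank, so its inverse
   preserves [A] as well. *)
have st (A : 'M[R]_n) : (A *m X <= A)%MS -> (A *m g == A)%MS.
  move=> AX; have AY : (A <= A *m (1%:M + X))%MS.
    have sAX : (A *m (1%:M + X) <= A)%MS by rewrite mulmxDr mulmx1 addmx_sub.
    have [_ /esym] := mxrank_leqif_eq sAX.
    by rewrite mxrankMfree ?row_free_unit // eqxx => /andP[].
  have sAg : (A *m g <= A)%MS.
    rewrite /g mulmxBr mulmx1 addmx_sub ?eqmx_opp // mul_scalar_mx.
    by rewrite -scalemxAr scalemx_sub // submx_invmx.
  have [_ <-] := mxrank_leqif_eq sAg.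
  by rewrite mxrankMfree // row_free_unit.
by split; [split; [|split]|]; [|exact: st|exact: st|exact: st].
Qed.

(** The differential of the Cayley transform, v |-> - 2 (1 + X x)^-1 (X v) (1 + X x)^-1, is
    injective wherever it is defined, so the whole of [D] can serve as domain of the piece. *)
Lemma real_dim_Hstab S (L : {vspace 'M[R]_n}) :
  (forall X, X \in L <-> stab_algebra S X) ->
  real_dim (Hstab B U W S) = \dim L.
Proof.
move=> LP; apply/eqP; rewrite eqn_leq; apply/andP; split.
  apply: real_dim_le => e; apply: C1_piece_dim_le => f df u fu Hf.
  exists L, (invmx (f u)); split=> // [|v]; last exact/LP/Hstab_tangent.
  by rewrite unitmx_inv; have [[[]]] := nbhs_singleton Hf.
apply: real_dim_ge.
  by apply: leq_trans (dimvS (subvf L)) _; rewrite dimvf dim_matrix.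
have [X [Xi XL]] := vspace_param L.
pose f x := 2%:M *m invmx (1%:M + X x) - 1%:M.
pose D := [set x | 1%:M + X x \in unitmx].
have XC x : C1_at (fun x => 1%:M + X x) (fun _ v => 0 + X v) x.
  by apply: C1_at_add; [exact: C1_at_cst|exact: C1_at_linear].
have oD : open D.
  rewrite openE => x Dx; apply: (@near_unitmx R _ (nbhs x) _ _ _ _ _ Dx).
  exact: C1_at_continuous (XC x).
have fC x : D x -> C1_at f (fun x v => 0 *m invmx (1%:M + X x) + 
   2%:M *m (- (invmx (1%:M + X x) *m (0 + X v) *m invmx (1%:M + X x))) + 0) x.
  move=> Dx; apply: C1_at_add; last exact: C1_at_cst.
  apply: C1_at_mulmx; first exact: C1_at_cst.
  exact: C1_at_invmx.
exists D, f; split.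
- exact: oD.
- by exists 0; rewrite /D /= linear0 addr0 unitmx1.
- apply: C1_immersion_onP fC _ => // x Dx v w.
  rewrite !mul0mx !add0r !addr0 !mul_scalar_mx => /(scalerI _); rewrite pnatr_eq0.
  move=> /(_ isT) /oppr_inj; rewrite -!mulmxA => /(can_inj (mulKmx _)).
  by rewrite unitmx_inv => /(_ Dx) /(can_inj (mulmxK (etrans (unitmx_inv _) Dx))) /Xi.
- by move=> _ [x Dx <-]; apply: cayley_Hstab => //; exact/LP.
Qed.

End Stabilizers.

(** * Tangent vectors of an orbit *)

Section OrthogonalProjection.
Variable R : realType.

Lemma gram_unitmx r n (A : 'M[R]_(r, n)) :
  row_free A -> A *m A^T \in unitmx.
Proof.
move=> fA; rewrite -row_free_unit; apply: inj_row_free => v vAA.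
suff : v *m A = 0 by move/eqP; rewrite mulmx_free_eq0 // => /eqP.
have : (v *m A) *m (v *m A)^T = 0 by rewrite trmx_mul !mulmxA -(mulmxA v) vAA mul0mx.
move=> /matrixP /(_ 0 0); rewrite !mxE => /eqP.
rewrite psumr_eq0 => [/allP vA|i _]; last by rewrite !mxE -expr2 sqr_ge0.
apply/rowP => i; have := vA i (mem_index_enum _); rewrite !mxE -expr2 sqrf_eq0.
by move=> /eqP.
Qed.

(** The orthogonal projection onto the row space of [A] when [A] has full row rank; as a rational
    expression in [A] it can be differentiated along a family of bases. *)
Definition row_proj r n (A : 'M[R]_(r, n)) : 'M[R]_n :=
  A^T *m invmx (A *m A^T) *m A.

Lemma row_projK r n (A : 'M[R]_(r, n)) : row_free A -> A *m row_proj A = A.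
Proof. by move=> fA; rewrite /row_proj !mulmxA mulmxV ?mul1mx ?gram_unitmx. Qed.

Lemma row_proj_grassmannian r n (A : 'M[R]_(r, n)) : row_free A ->
  grassmannian r (row_proj A) /\ (row_proj A == A)%MS.
Proof.
move=> fA; have AP : (row_proj A == A)%MS.
  by rewrite submxMl /= -{1}(row_projK fA) submxMl.
split=> //; split; last split.
- by rewrite /row_proj !trmx_mul trmxK trmx_inv trmx_mul trmxK mulmxA.
- by rewrite [X in X *m _]/row_proj -(mulmxA _ A) row_projK.
- by rewrite (eqmx_rank AP); exact/eqP.
Qed.
End OrthogonalProjection.

(** * Lower bound for the dimension of an orbit *)

Section OrbitLowerBound.
Variables (R : realType) (n : nat) (B U W S : 'M[R]_n).
Variables L LS : {vspace 'M[R]_n}.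
Hypothesis uB : B \in unitmx.
Hypothesis LP : forall X, X \in L <-> stab_algebra B U W 0 X.
Hypothesis LSP : forall X, X \in LS <-> stab_algebra B U W S X.

Lemma stab_algebra_sub : (LS <= L)%VS.
Proof.
by apply/subvP => X /LSP[? ? ? ?]; apply/LP; split=> //; rewrite mul0mx sub0mx.
Qed.

(** Injectivity at 0 comes from differentiating A f = A: if [df 0 v] = 0, then the rows of [dA 0 v]
    lie in [S]. Up to the factor -2 these rows span the image of [S] under [X v], so [X v] lies both
    in [LS] and in a complement of it. *)
Lemma real_dim_orbit_ge :
  (\dim L - \dim LS <= real_dim (Horbit B U W (\rank S) S))%N.
Proof.
have -> : (\dim L - \dim LS)%N = \dim (L :\: LS)%VS.
  by rewrite -(dimv_cap_compl L LS) (capv_idPr stab_algebra_sub) addKn.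
have dle : (\dim (L :\: LS)%VS <= n * n)%N.
  by apply: leq_trans (dimvS (subvf _)) _; rewrite dimvf dim_matrix.
have [d dE [X [Xi XC]]] : exists2 d, \dim (L :\: LS)%VS = d &
    exists X : {linear 'rV[R]_d -> 'M[R]_n},
      injective X /\ forall x, X x \in (L :\: LS)%VS.
  by exists (\dim (L :\: LS)%VS) => //; exact: vspace_param.
rewrite dE in dle *; apply: real_dim_ge => //.
have XL x : stab_algebra B U W 0 (X x).
  by apply/LP/(subvP (diffvSl L LS)); exact: XC.
pose g x := 2%:M *m invmx (1%:M + X x) - 1%:M.
pose D := [set x | 1%:M + X x \in unitmx].
have gH x : D x -> Hgroup B U W (g x).
  by move=> Dx; have [] := cayley_Hstab uB (XL x) Dx.
pose A x := row_base S *m g x.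
have Af x : D x -> row_free (A x).
  move=> Dx; have [[ug _] _] := gH x Dx.
  by rewrite /row_free mxrankMfree ?row_free_unit // eq_row_base.
pose f x := row_proj (A x).
have XC1 x : C1_at (fun x => 1%:M + X x) (fun _ v => 0 + X v) x.
  by apply: C1_at_add; [exact: C1_at_cst|exact: C1_at_linear].
have D_nbhs x : D x -> nbhs x D.
  move=> Dx; apply: (@near_unitmx R _ (nbhs x) _ _ _ _ _ Dx).
  exact: C1_at_continuous (XC1 x).
pose dg x v := 0 *m invmx (1%:M + X x) + 
   2%:M *m (- (invmx (1%:M + X x) *m (0 + X v) *m invmx (1%:M + X x))) + 0.
have gC x : D x -> C1_at g dg x.
  move=> Dx; apply: C1_at_add; last exact: C1_at_cst.
  by apply: C1_at_mulmx; [exact: C1_at_cst|exact: C1_at_invmx].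
pose dA x v := 0 *m g x + row_base S *m dg x v.
have AC x : D x -> C1_at A dA x.
  by move=> Dx; apply: C1_at_mulmx; [exact: C1_at_cst|exact: gC].
(* The formula of [df] is left to unification: only the relation A f = A is used to control it. *)
have [df fC] : exists df, forall x, D x -> C1_at f df x.
  eexists => x Dx; apply: C1_at_mulmx (AC x Dx).
  apply: C1_at_mulmx; first exact: C1_at_trmx (AC x Dx).
  apply: C1_at_invmx; last exact/gram_unitmx/Af.
  by apply: C1_at_mulmx (AC x Dx) _; exact: C1_at_trmx (AC x Dx).
have D0 : D 0 by rewrite /D /= linear0 addr0 unitmx1.
have dfl x : D x -> linear (df x).
  by move=> Dx; have [[_ <-] _] := fC x Dx; exact: linearP.
have df0 v : df 0 v = 0 -> v = 0.
  move=> dfv.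
  have [Ad _] := AC 0 D0; have [fd _] := fC 0 D0.
  have E : dA 0 v *m f 0 + A 0 *m df 0 v - dA 0 v = 0.
    apply: (is_diff_near_cst (c := 0) v (is_diffB (is_diff_mulmx Ad fd) Ad)).
    apply: filterS (D_nbhs 0 D0) => x Dx.
    suff Ex : A x *m f x - A x = 0 by exact: Ex.
    by rewrite (row_projK (Af x Dx)) subrr.
  move: E; rewrite dfv mulmx0 addr0 => /subr0_eq E.
  have g0 : g 0 = 1%:M.
    by rewrite /g linear0 addr0 invmx1 mulmx1 -[2]/(1 + 1) raddfD addrK.
  have f0S : (f 0 <= S)%MS.
    have [_ /andP[sub _]] := row_proj_grassmannian (Af 0 D0).
    by apply: submx_trans sub _; rewrite /A g0 mulmx1 eq_row_base.
  have SX : (S *m X v <= S)%MS.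
    rewrite -(eqmxMr (X v) (eq_row_base S)).
    have := submx_trans (submxMl (dA 0 v) (f 0)) f0S; rewrite E /dA /dg.
    rewrite !mul0mx !add0r addr0 linear0 addr0 invmx1 mulmx1 mul1mx mulmxN.
    by rewrite mul_scalar_mx mulmxN -scalemxAr eqmx_opp eqmx_scale // pnatr_eq0.
  have XLS : X v \in LS by apply/LSP; have [? ? ? _] := XL v.
  apply: Xi; rewrite linear0; apply/eqP; rewrite -memv0 -(capv_diff L LS).
  by rewrite memv_cap XC.
(* Injectivity is known at 0 alone and extends to a neighbourhood, to which the domain is shrunk. *)
pose E := [set x | D x /\ injective (df x)].
have E0 : nbhs (0 : 'rV[R]_d) E.
  apply: filterI; first exact: D_nbhs.
  apply: near_injective => //; first by have [] := fC 0 D0.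
  by apply: filterS (D_nbhs 0 D0) => x; exact: dfl.
move: E0; rewrite nbhsE => -[D' [oD' D'0] D'E].
exists D', f; split => //.
- by exists 0.
- apply: C1_immersion_onP => [|x|x]; first exact: oD'.
  + by move=> /D'E[Dx _]; exact: fC.
  + by move=> /D'E[].
- move=> _ [x /D'E[Dx _] <-].
  have [Pg PA] := row_proj_grassmannian (Af x Dx).
  split=> //; exists (g x); first exact: gH.
  apply/eqmxP/(eqmx_trans (eqmxP PA)).
  by apply: eqmxMr; exact: eq_row_base.
Qed.

End OrbitLowerBound.

(** * Invariants and tangent equations in terms of the projection onto U *)

Lemma eqmx_mxrank_gram (R : fieldType) m1 m2 n (A : 'M[R]_(m1, n))
    (A' : 'M[R]_(m2, n)) (G : 'M[R]_n) :
  (A :=: A')%MS -> \rank (A *m G *m A^T) = \rank (A' *m G *m A'^T).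
Proof.
wlog suff le : m1 m2 A A' / (A :=: A')%MS ->
    (\rank (A *m G *m A^T) <= \rank (A' *m G *m A'^T))%N.
  by move=> AA'; apply/eqP; rewrite eqn_leq !le //; exact: eqmx_sym.
move=> AA'; have /submxP[D ->] : (A <= A')%MS by rewrite AA'.
rewrite trmx_mul !mulmxA; apply: leq_trans (mxrankM_maxl _ _) _.
by rewrite -!mulmxA; apply: leq_trans (mxrankM_maxr _ _) _; rewrite !mulmxA.
Qed.

Section Projection.
Variables (R : realType) (n : nat) (B U W pi : 'M[R]_n).
Hypothesis symB : B^T = B.
Hypothesis pi_idem : pi *m pi = pi.
Hypothesis piU : (U == pi)%MS.
Hypothesis piW : (W == 1%:M - pi)%MS.
Hypothesis piB : pi *m B = B *m pi^T.

Lemma sub_pi m (A : 'M[R]_(m, n)) : (A <= U)%MS -> A *m pi = A.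
Proof. by rewrite (eqmxP piU) => /submxP[D ->]; rewrite -mulmxA pi_idem. Qed.

Lemma sub_pi' m (A : 'M[R]_(m, n)) : (A <= W)%MS -> A *m pi = 0.
Proof.
rewrite (eqmxP piW) => /submxP[D ->].
by rewrite -mulmxA mulmxBl mul1mx pi_idem subrr mulmx0.
Qed.

Lemma pi_sub m (A : 'M[R]_(m, n)) : A *m pi = A -> (A <= U)%MS.
Proof. by rewrite (eqmxP piU) => <-; exact: submxMl. Qed.

Lemma pi_sub' m (A : 'M[R]_(m, n)) : A *m pi = 0 -> (A <= W)%MS.
Proof.
rewrite (eqmxP piW) => A0; rewrite -[A](_ : A *m (1%:M - pi) = A) ?submxMl //.
by rewrite mulmxBr mulmx1 A0 subr0.
Qed.

(** Commutation with [pi] replaces the two stability conditions by a single linear equation;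
    [pi_stable] is the way back. *)
Lemma stable_pi (X : 'M[R]_n) :
  (U *m X <= U)%MS -> (W *m X <= W)%MS -> pi *m X = X *m pi.
Proof.
move=> UX WX.
have pX : pi *m X *m pi = pi *m X.
  by apply: sub_pi; apply: submx_trans UX; rewrite (eqmxMr _ (eqmxP piU)).
have pX' : (1%:M - pi) *m X *m pi = 0.
  by apply: sub_pi'; apply: submx_trans WX; rewrite (eqmxMr _ (eqmxP piW)).
by move: pX'; rewrite mulmxBl mul1mx mulmxBl pX => /subr0_eq ->.
Qed.

Lemma pi_stable (X : 'M[R]_n) : pi *m X = X *m pi ->
  (U *m X <= U)%MS /\ (W *m X <= W)%MS.
Proof.
move=> pX; split; [apply: pi_sub|apply: pi_sub']; rewrite -mulmxA -pX mulmxA.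
- by rewrite sub_pi.
- by rewrite sub_pi' ?mul0mx.
Qed.

Lemma Hgroup_pi h : Hgroup B U W h -> pi *m h = h *m pi.
Proof. by move=> [_ [/andP[Uh _] /andP[Wh _]]]; exact: stable_pi. Qed.

Lemma Horbit_ranks r S P : Horbit B U W r S P ->
  [/\ \rank P = \rank S, \rank (P *m pi) = \rank (S *m pi),
      \rank (P *m (1%:M - pi)) = \rank (S *m (1%:M - pi)),
      \rank (P *m (pi *m B) *m P^T) = \rank (S *m (pi *m B) *m S^T) &
      (S *m B *m S^T = 0 -> P *m B *m P^T = 0)].
Proof.
move=> [_ [h Hh /eqmxP PSh]]; have [[uh hB] _] := Hh; have hpi := Hgroup_pi Hh.
have fh : row_free h by rewrite row_free_unit.
have hpi' : h *m (1%:M - pi) = (1%:M - pi) *m h.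
  by rewrite mulmxBl mulmxBr mulmx1 mul1mx hpi.
split.
- by rewrite PSh mxrankMfree.
- by rewrite (eqmxMr pi PSh) -mulmxA -hpi mulmxA mxrankMfree.
- by rewrite (eqmxMr _ PSh) -mulmxA hpi' mulmxA mxrankMfree.
- rewrite (eqmx_mxrank_gram _ PSh) trmx_mul !mulmxA -(mulmxA S h pi) -hpi mulmxA.
  by rewrite -(mulmxA (S *m pi) h) -(mulmxA (S *m pi) (h *m B)) hB.
- move=> SB; apply/eqP; rewrite -mxrank_eq0 (eqmx_mxrank_gram _ PSh) trmx_mul.
  by rewrite !mulmxA -(mulmxA S h B) -(mulmxA S (h *m B)) hB SB mxrank0.
Qed.

(* The tangent vector Q at P is studied through the form (s, t) |-> B(s Q, t) on
   S x S^perp. The last three conditions express that P pi, P (1 - pi) and the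
   Gram matrix P pi B P^T have constant rank. *)
Definition orbit_tangent (P Q : 'M[R]_n) :=
  [/\ Q^T = Q, Q *m P + P *m Q = Q &
      P *m Q *m B *m P^T + (P *m Q *m B *m P^T)^T = 0] /\
  [/\ forall k l (M : 'M[R]_(k, n)) (N : 'M[R]_(l, n)),
        (M <= P)%MS -> M *m pi = 0 -> N *m B *m P^T = 0 -> N *m pi = N ->
        M *m Q *m B *m N^T = 0,
      forall k l (M : 'M[R]_(k, n)) (N : 'M[R]_(l, n)),
        (M <= P)%MS -> M *m pi = M -> N *m B *m P^T = 0 -> N *m pi = 0 ->
        M *m Q *m B *m N^T = 0 &
      forall k l (M : 'M[R]_(k, n)) (N : 'M[R]_(l, n)),
        (M <= P)%MS -> (N <= P)%MS ->
        M *m pi *m B *m P^T = 0 -> N *m pi *m B *m P^T = 0 ->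
        M *m Q *m B *m (N *m pi)^T + (N *m Q *m B *m (M *m pi)^T)^T = 0].

Lemma Horbit_tangent e r S (f df : 'rV[R]_e -> 'M[R]_n) u v :
  S *m B *m S^T = 0 ->
  is_diff u f df -> (\forall x \near u, Horbit B U W r S (f x)) ->
  orbit_tangent (f u) (df v).
Proof.
move=> SB fu Of; have cd m1 m2 (A : 'M[R]_(m1, m2)) :
  is_diff u (fun=> A) (fun=> 0) by exact: is_diff_cst.
have td := is_diff_comp fu (is_diff_linear_mx (@trmx R n n) _).
have [[Psym [PP _]] _] := nbhs_singleton Of.
have [_ rpi rpi' rG _] := Horbit_ranks (nbhs_singleton Of).
set P := f u in Psym PP rpi rpi' rG *; set Q := df v.
have Qsym : Q^T = Q.
  apply/subr0_eq; apply: (is_diff_near_cst (c := 0) v (is_diffB td fu)).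
  apply: filterS Of => x [[xsym _] _].
  by suff E : (f x)^T - f x = 0; [exact: E|rewrite xsym subrr].
have QP : Q *m P + P *m Q = Q.
  apply/subr0_eq.
  apply: (is_diff_near_cst (c := 0) v (is_diffB (is_diff_mulmx fu fu) fu)).
  apply: filterS Of => x [[_ [xx _]] _].
  by suff E : f x *m f x - f x = 0; [exact: E|rewrite xx subrr].
have QB : Q *m B *m P + P *m B *m Q = 0.
  have := is_diff_near_cst (c := 0) v
    (is_diff_mulmx (is_diff_mulmx fu (cd _ _ B)) td).
  rewrite mulmx0 addr0 /= Psym Qsym; apply.
  by apply: filterS Of => x /Horbit_ranks[_ _ _ _ /(_ SB) E]; exact: E.
have MP k (M : 'M[R]_(k, n)) : (M <= P)%MS -> M *m P = M.
  by move=> /submxP[D ->]; rewrite -mulmxA PP.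
(* [A] will be [pi] or its complement. The rows of [M] lie in the left kernel of [P *m A] and the
   columns of [B *m N^T] in its right kernel, as [constant_rank_diff] requires. *)
have rank_pi (A : 'M[R]_n) k l (M : 'M[R]_(k, n)) (N : 'M[R]_(l, n)) :
    (\forall x \near u, \rank (f x *m A) = \rank (P *m A)) ->
    (M <= P)%MS -> M *m A = 0 -> A *m (B *m N^T) = B *m N^T ->
    P *m B *m N^T = 0 -> M *m Q *m B *m N^T = 0.
  move=> rA MleP MA AN PN.
  have := constant_rank_diff v (K := M) (C := B *m N^T)
    (is_diff_mulmx fu (cd _ _ A)) rA.
  rewrite mulmx0 addr0 mulmxA MP // => /(_ MA).
  rewrite -(mulmxA P) AN mulmxA => /(_ PN).
  by rewrite -(mulmxA M) -(mulmxA Q) AN !mulmxA.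
have symG : (pi *m B)^T = pi *m B by rewrite trmx_mul symB -piB.
have PBN l (N : 'M[R]_(l, n)) : N *m B *m P^T = 0 -> P *m B *m N^T = 0.
  move=> NB; apply: trmx_inj; rewrite trmx0 -NB !trmx_mul !trmxK symB.
  by rewrite mulmxA.
split; split=> //.
- have := congr1 (fun X => P *m X *m P) QB; rewrite mulmx0 mul0mx => <-.
  rewrite mulmxDr mulmxDl !trmx_mul trmxK symB Qsym Psym !mulmxA PP.
  by rewrite -(mulmxA (P *m Q *m B) P) PP.
- move=> k l M N MleP Mpi NB Npi.
  apply: (rank_pi pi) => //; last exact: PBN.
  + by apply: filterS Of => x /Horbit_ranks[_ -> _ _ _].
  + by rewrite mulmxA piB -mulmxA -trmx_mul Npi.
- move=> k l M N MleP Mpi NB Npi.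
  apply: (rank_pi (1%:M - pi)) => //; last exact: PBN.
  + by apply: filterS Of => x /Horbit_ranks[_ _ -> _ _].
  + by rewrite mulmxBr mulmx1 Mpi subrr.
  + rewrite mulmxBl mul1mx mulmxA piB -mulmxA -trmx_mul Npi.
    by rewrite trmx0 mulmx0 subr0.
- move=> k l M N MP' NP' MG NG.
  have gd := is_diff_mulmx (is_diff_mulmx fu (cd _ _ (pi *m B))) td.
  have rG' : \forall x \near u,
      \rank (f x *m (pi *m B) *m (f x)^T) = \rank (P *m (pi *m B) *m P^T).
    by apply: filterS Of => x /Horbit_ranks[_ _ _ -> _].
  have := constant_rank_diff v (K := M) (C := N^T) gd rG'.
  rewrite /= mulmx0 addr0 !mulmxA MP // => /(_ MG).
  have NG' : P *m pi *m B *m P^T *m N^T = 0.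
    apply: trmx_inj; rewrite trmx0 -NG trmx_mul trmxK trmx_mul trmxK.
    by rewrite -(mulmxA P) trmx_mul symG !mulmxA MP.
  move=> /(_ NG'); rewrite mulmxDr mulmxDl !mulmxA MP // => <-; congr (_ + _).
    rewrite -(mulmxA (M *m Q *m pi *m B)) -trmx_mul MP // trmx_mul.
    by rewrite -(mulmxA (M *m Q) pi) piB !mulmxA.
  by rewrite !trmx_mul !trmxK symB Qsym !mulmxA.
Qed.

End Projection.

(** * Counting the dimension of a space of matrices *)

Section DimensionCounting.
Variables (R : realType) (n : nat).
Implicit Types (P : 'M[R]_n -> Prop) (G C : 'M[R]_n).

(** [G] will be the product of an unknown matrix with [B]; each such condition is then a block of
    linear equations on the unknown. *)
Definition mxortho G m1 m2 (M : 'M[R]_(m1, n)) (N : 'M[R]_(m2, n)) :=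
  M *m G *m N^T == 0.

Lemma mxortho_sub G m1 m2 m3 m4 (M : 'M[R]_(m1, n)) (N : 'M[R]_(m2, n))
    (M' : 'M[R]_(m3, n)) (N' : 'M[R]_(m4, n)) :
  (M <= M')%MS -> (N <= N')%MS -> mxortho G M' N' -> mxortho G M N.
Proof.
move=> /submxP[A ->] /submxP[A' ->] /eqP MN.
by rewrite /mxortho trmx_mul !mulmxA -(mulmxA A) -(mulmxA A) MN mulmx0 mul0mx.
Qed.

Lemma mxortho_addsl G m1 m2 m3 (M : 'M[R]_(m1, n)) (M' : 'M[R]_(m2, n))
    (N : 'M[R]_(m3, n)) :
  mxortho G (M + M')%MS N = mxortho G M N && mxortho G M' N.
Proof.
apply/idP/andP => [MN|[/eqP MN /eqP MN']].
  by split; apply: mxortho_sub MN; rewrite ?addsmxSl ?addsmxSr.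
apply: (@mxortho_sub _ _ _ _ _ _ _ (col_mx M M') N) => //.
  by rewrite addsmxE.
by rewrite /mxortho !mul_col_mx MN MN' col_mx0.
Qed.

Lemma mxortho_addsr G m1 m2 m3 (M : 'M[R]_(m1, n)) (N : 'M[R]_(m2, n))
    (N' : 'M[R]_(m3, n)) :
  mxortho G M (N + N')%MS = mxortho G M N && mxortho G M N'.
Proof.
apply/idP/andP => [MN|[/eqP MN /eqP MN']].
  by split; apply: mxortho_sub MN; rewrite ?addsmxSl ?addsmxSr.
apply: (@mxortho_sub _ _ _ _ _ _ _ M (col_mx N N')) => //.
  by rewrite addsmxE.
by rewrite /mxortho tr_col_mx mul_mx_row MN MN' row_mx0.
Qed.

Lemma mxortho_skewC G m1 m2 (M : 'M[R]_(m1, n)) (N : 'M[R]_(m2, n)) :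
  G + G^T = 0 -> mxortho G M N = mxortho G N M.
Proof.
move=> /eqP; rewrite addrC addr_eq0 => /eqP Gskew.
rewrite /mxortho -[LHS]trmx_eq0 !trmx_mul trmxK Gskew mulmxA.
by rewrite mulmxN mulNmx oppr_eq0.
Qed.

(** Quantifying over the subspaces contained in [P] allows conditions to be added to the predicate
    one at a time, without building a solution space at each stage. *)
Definition dim_le P d := forall L : {vspace 'M[R]_n},
  (forall X, X \in L -> P X) -> (\dim L <= d)%N.

Lemma dim_le0 P : (forall X, P X -> X = 0) -> dim_le P 0.
Proof.
move=> P0 L LP; rewrite leqn0 dimv_eq0 -subv0; apply/subvP => X /LP /P0 ->.
exact: mem0v.
Qed.

(** Rank-nullity: imposing [f X = 0] lowers the dimension by at most [dim vT]. *)
Lemma dim_le_linear (vT : vectType R) (f : {linear 'M[R]_n -> vT}) P k d :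
  dim vT = k -> dim_le (fun X => P X /\ f X = 0) d -> dim_le P (k + d).
Proof.
move=> <- Pf L LP; rewrite -(limg_ker_dim (linfun f) L) addnC; apply: leq_add.
  by rewrite -dimvf dimvS ?subvf.
apply: Pf => X; rewrite memv_cap memv_ker => /andP[XL]; rewrite lfunE => /eqP.
by split=> //; exact: LP.
Qed.

Lemma dim_le_ortho P d C (M N : 'M[R]_n) :
  dim_le (fun X => P X /\ mxortho (X *m C) M N) d ->
  dim_le P (\rank M * \rank N + d).
Proof.
move=> PMN; pose f X := row_base M *m X *m (C *m (row_base N)^T).
have fl : linear f.
  by move=> a X Y; rewrite /f mulmxDr mulmxDl -scalemxAr -scalemxAl.
pose lf : {linear _ -> _} := HB.pack f (GRing.isLinear.Build _ _ _ _ _ fl).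
apply: (dim_le_linear (f := lf)); first exact: dim_matrix.
move=> L LP.
apply: PMN => X /LP[PX fX]; split=> //.
apply: (@mxortho_sub _ _ _ _ _ _ _ (row_base M) (row_base N)).
- by rewrite eq_row_base.
- by rewrite eq_row_base.
- by apply/eqP; move: fX; rewrite /= /f !mulmxA.
Qed.

Lemma card_ltn_pairs m : #|{: {x : 'I_m * 'I_m | (x.1 < x.2)%N}}| = 'C(m, 2).
Proof.
rewrite card_sig -sum1_card big_mkcond /=.
rewrite -(pair_bigA _ (fun i j : 'I_m => if (i < j)%N then 1 else 0)%N) /=.
rewrite exchange_big /= -bin2_sum big_mkord; apply: eq_bigr => j _.
rewrite -big_mkcond -(big_ord_widen m (fun=> 1%N)) ?sum1_card ?card_ord //.
exact/ltnW.
Qed.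

(** A skew block vanishes once its strictly upper entries do, so it costs one parameter per pair of
    basis vectors of [M]. *)
Lemma dim_le_skew P d C (M : 'M[R]_n) :
  (forall X, P X -> M *m (X *m C) *m M^T + (M *m (X *m C) *m M^T)^T = 0) ->
  dim_le (fun X => P X /\ mxortho (X *m C) M M) d ->
  dim_le P ('C(\rank M, 2) + d).
Proof.
move=> skewP PMN; pose b := row_base M.
pose T := {x : 'I_(\rank M) * 'I_(\rank M) | (x.1 < x.2)%N}.
pose f X : 'rV[R]_#|{: T}| :=
  \row_k (b *m X *m (C *m b^T)) (val (enum_val k)).1 (val (enum_val k)).2.
have fl : linear f.
  move=> a X Y; apply/rowP => k; rewrite [LHS]mxE mulmxDr mulmxDl.
  by rewrite -scalemxAr -scalemxAl !mxE.
pose lf : {linear _ -> _} := HB.pack f (GRing.isLinear.Build _ _ _ _ _ fl).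
apply: (dim_le_linear (f := lf)).
  by rewrite dim_matrix mul1r card_ltn_pairs.
move=> L LP; apply: PMN => X /LP[PX fX]; split=> //.
apply: (@mxortho_sub _ _ _ _ _ _ _ b b); rewrite ?eq_row_base //.
have /submxP[D bD] : (b <= M)%MS by rewrite eq_row_base.
have [Y YE] : exists Y, Y = b *m X *m (C *m b^T) by eexists.
have Yskew : Y + Y^T = 0.
  rewrite YE bD trmx_mul !mulmxA.
  have := congr1 (fun Z => D *m Z *m D^T) (skewP X PX).
  rewrite mulmx0 mul0mx mulmxDr mulmxDl => <-.
  by rewrite !trmx_mul !trmxK !mulmxA.
have Y0 (i j : 'I_(\rank M)) : (i < j)%N -> Y i j = 0.
  move=> ij; have := congr1
    (fun r : 'rV[R]_#|{: T}| => r 0 (enum_rank (exist _ (i, j) ij : T))) fX.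
  by rewrite [LHS]mxE [RHS]mxE enum_rankK -YE.
apply/eqP; rewrite !mulmxA -(mulmxA (b *m X)) -YE; apply/matrixP => i j.
have Yij : Y i j = - Y j i.
  apply/eqP; rewrite -addr_eq0.
  by have := congr1 (fun Z : 'M[R]_(\rank M) => Z i j) Yskew;
     rewrite !mxE => ->.
rewrite mxE; case: (ltngtP i j) => [/Y0 //|ji|/val_inj ij].
  by rewrite Yij Y0 ?oppr0.
by move: Yij; rewrite ij => /eqP; rewrite -addr_eq0 -mulr2n mulrn_eq0 => /eqP.
Qed.

End DimensionCounting.

(** * Subspaces adapted to an isotropic subspace *)

Section AdaptedSubspaces.
Variables (R : realType) (n : nat) (B S : 'M[R]_n).
Hypothesis symB : B^T = B.
Hypothesis uB : B \in unitmx.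
Hypothesis isoS : S *m B *m S^T = 0.
Implicit Types e pi : 'M[R]_n.

(* For e the projection onto U along W, fixpart e is S :&: U, radpart e is the set
   of s in S such that s e lies in Rad (P_U S), and perppart e is U :&: S^perp.
   The remaining parts are complements, chosen so that
     S = fixpart e + fixpart (1 - e) + apart e + ypart e,
     U = fixpart e + (apart e) e + (ypart e) e + zpart e + (dpart e) e + fpart e
   are direct sums. *)
Definition Sperp : 'M[R]_n := kermx (B *m S^T).
Definition fixpart e : 'M[R]_n := (S :&: kermx (1%:M - e))%MS.
Definition radpart e : 'M[R]_n := (S :&: kermx (e *m B *m S^T))%MS.
Definition perppart e : 'M[R]_n := (e :&: Sperp)%MS.
Definition zpart e : 'M[R]_n := (perppart e :\: radpart e *m e)%MS.
Definition apart e : 'M[R]_n := 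
  (radpart e :\: (fixpart e + fixpart (1%:M - e)))%MS.
Definition ypart e : 'M[R]_n := (S :\: radpart e)%MS.
Definition dpart e : 'M[R]_n :=
  (Sperp :\: (perppart e + perppart (1%:M - e) + S))%MS.
Definition fpart e : 'M[R]_n := (e :\: Sperp *m e)%MS.

(** A projection whose image and kernel are [B]-orthogonal. The notion is stable under e |-> 1 - e,
    which transfers every statement about U to W. *)
Definition selfadj_idem e := e *m e = e /\ e *m B = B *m e^T.

Lemma selfadj_idemC e : selfadj_idem e -> selfadj_idem (1%:M - e).
Proof.
move=> [ee eB]; split; last first.
  by rewrite linearB /= trmx1 mulmxBl mulmxBr mul1mx mulmx1 eB.
by rewrite mulmxBl mul1mx mulmxBr mulmx1 ee subrr subr0.
Qed.

Lemma addsmx_diffK (A C : 'M[R]_n) : (A <= C)%MS -> (A + (C :\: A) :=: C)%MS.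
Proof.
move=> sAC; apply/eqmxP; rewrite addsmx_sub sAC diffmxSl /=.
rewrite -{1}(addsmx_diff_cap_eq C A) addsmx_sub addsmxSr /=.
exact: submx_trans (capmxSr _ _) (addsmxSl _ _).
Qed.

Lemma rank_diffmx (A C : 'M[R]_n) : (A <= C)%MS ->
  (\rank (C :\: A)%MS + \rank A = \rank C)%N.
Proof.
move=> sAC; rewrite addnC -(mxrank_cap_compl C A); congr (_ + _)%N.
apply/eqmx_rank/andP; split; last exact: capmxSr.
by rewrite sub_capmx sAC submx_refl.
Qed.

Lemma fixpartP m e (M : 'M[R]_(m, n)) :
  (M <= fixpart e)%MS = (M <= S)%MS && (M *m e == M).
Proof.
by rewrite sub_capmx sub_kermx mulmxBr mulmx1 subr_eq0 [M == _]eq_sym.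
Qed.

Lemma sub_idem m e (M : 'M[R]_(m, n)) :
  selfadj_idem e -> (M <= e)%MS = (M *m e == M).
Proof.
move=> [ee _]; apply/idP/eqP => [/submxP[D ->]|<-]; last exact: submxMl.
by rewrite -mulmxA ee.
Qed.

Lemma sub_Sperp m (M : 'M[R]_(m, n)) : (M <= Sperp)%MS = mxortho B M S.
Proof. by rewrite sub_kermx /mxortho mulmxA. Qed.

Lemma S_Sperp : (S <= Sperp)%MS.
Proof. by rewrite sub_Sperp; apply/eqP. Qed.

Lemma rank_Sperp : (\rank Sperp + \rank S = n)%N.
Proof.
rewrite mxrank_ker (eqmxMfull _ (_ : row_full B)) ?row_full_unit // mxrank_tr.
by rewrite subnK // rank_leq_row.
Qed.

Lemma mxortho_sym m1 m2 (M : 'M[R]_(m1, n)) (N : 'M[R]_(m2, n)) :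
  mxortho B M N = mxortho B N M.
Proof.
by rewrite /mxortho -[LHS]trmx_eq0 !trmx_mul trmxK symB mulmxA.
Qed.

Lemma idemC_id e : 1%:M - (1%:M - e) = e.
Proof. by rewrite opprB addrC subrK. Qed.

Lemma radpartP m e (M : 'M[R]_(m, n)) :
  (M <= radpart e)%MS = (M <= S)%MS && mxortho B (M *m e) S.
Proof. by rewrite sub_capmx sub_kermx /mxortho !mulmxA. Qed.

(** As [S] is isotropic, the two components of a vector of [S] have opposite pairings with [S].
    Hence a(S) takes the same value on both sides. *)
Lemma radpartC e : (radpart (1%:M - e) :=: radpart e)%MS.
Proof.
have sub (M : 'M[R]_n) : (M <= radpart (1%:M - e))%MS = (M <= radpart e)%MS.
  rewrite !radpartP; case MS : (M <= S)%MS => //=.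
  have /eqP M0 : mxortho B M S by rewrite -sub_Sperp (submx_trans MS S_Sperp).
  by rewrite /mxortho mulmxBr mulmx1 !mulmxBl M0 sub0r oppr_eq0.
by apply/eqmxP; rewrite -sub submx_refl sub submx_refl.
Qed.

Lemma rank_fixpart e : (\rank (fixpart e) + \rank (S *m (1%:M - e)) = \rank S)%N.
Proof. by rewrite addnC mxrank_mul_ker. Qed.

Lemma rank_radpart e :
  (\rank (radpart e) + \rank (S *m (e *m B) *m S^T) = \rank S)%N.
Proof. by rewrite addnC -(mxrank_mul_ker S (e *m B *m S^T)) !mulmxA. Qed.

Section OneProjection.
Variable e : 'M[R]_n.
Hypothesis se : selfadj_idem e.
Local Notation e' := (1%:M - e).

Lemma perppartP m (M : 'M[R]_(m, n)) :
  (M <= perppart e)%MS = (M *m e == M) && mxortho B M S.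
Proof. by rewrite sub_capmx sub_idem // sub_Sperp. Qed.

Lemma fix_radpart : (fixpart e <= radpart e)%MS.
Proof.
have := submx_refl (fixpart e); rewrite fixpartP radpartP => /andP[-> /eqP ->] /=.
by rewrite -sub_Sperp (submx_trans (capmxSl _ _) S_Sperp).
Qed.

Lemma rank_fixpart_sum :
  \rank (fixpart e + fixpart e')%MS = (\rank (fixpart e) + \rank (fixpart e'))%N.
Proof.
apply: mxrank_disjoint_sum; set C := (_ :&: _)%MS.
have := submx_refl C; rewrite {2}/C sub_capmx !fixpartP mulmxBr mulmx1.
move=> /andP[/andP[_ /eqP ->] /andP[_]].
by rewrite subrr eq_sym => /eqP.
Qed.

(** By self-adjointness e B S^T = B (S e)^T, so [perppart e] is the orthogonal of [S *m e] inside
    the image of [e]. *)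
Lemma rank_perppart : (\rank (perppart e) + \rank (S *m e) = \rank e)%N.
Proof.
rewrite addnC -(mxrank_mul_ker e (B *m S^T)); congr (_ + _)%N.
rewrite mulmxA (proj2 se) -mulmxA -trmx_mul.
by rewrite (eqmxMfull _ (_ : row_full B)) ?row_full_unit // mxrank_tr.
Qed.

Lemma rad_perppart : (radpart e *m e <= perppart e)%MS.
Proof.
rewrite perppartP -mulmxA (proj1 se) eqxx /=.
by have := submx_refl (radpart e); rewrite radpartP => /andP[].
Qed.

Lemma rank_radpartM :
  (\rank (radpart e *m e) + \rank (fixpart e') = \rank (radpart e))%N.
Proof.
rewrite -[RHS](mxrank_mul_ker _ e); congr (_ + _)%N.
apply/eqmx_rank/andP; split.
  rewrite sub_capmx sub_kermx.
  have := submx_refl (fixpart e'); rewrite fixpartP => /andP[ES].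
  rewrite mulmxBr mulmx1 -subr_eq0 addrAC subrr sub0r oppr_eq0 => E0.
  by rewrite radpartP ES E0 (eqP E0) /mxortho !mul0mx eqxx.
set C := (_ :&: _)%MS; have := submx_refl C.
rewrite {2}/C sub_capmx sub_kermx radpartP => /andP[/andP[CS _] /eqP Ce].
by rewrite fixpartP CS mulmxBr mulmx1 Ce subr0 eqxx.
Qed.

Lemma rank_zpart :
  (\rank (zpart e) + \rank (radpart e *m e) = \rank (perppart e))%N.
Proof. exact/rank_diffmx/rad_perppart. Qed.

Lemma sub_perpC : (perppart e' :=: Sperp :&: kermx e)%MS.
Proof.
apply/eqmxP; apply/andP; split; last first.
  set C := (_ :&: _)%MS; have := submx_refl C.
  rewrite {2}/C sub_capmx sub_kermx sub_Sperp => /andP[CS /eqP Ce].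
  rewrite sub_capmx sub_Sperp CS andbT (sub_idem _ (selfadj_idemC se)).
  by rewrite mulmxBr mulmx1 Ce subr0.
rewrite sub_capmx capmxSr sub_kermx /=.
have : (perppart e' <= e')%MS by exact: capmxSl.
rewrite (sub_idem _ (selfadj_idemC se)) mulmxBr mulmx1.
by rewrite -subr_eq0 addrAC subrr sub0r oppr_eq0.
Qed.

Lemma Sperp_sub : (Sperp *m e <= e)%MS.
Proof. exact: submxMl. Qed.

Lemma rank_fpart : (\rank (fpart e) + \rank (Sperp *m e) = \rank e)%N.
Proof. exact/rank_diffmx/Sperp_sub. Qed.

Lemma rank_SperpM :
  (\rank (Sperp *m e) + \rank (perppart e') = \rank Sperp)%N.
Proof. by rewrite sub_perpC mxrank_mul_ker. Qed.

Lemma span_perppart : (radpart e *m e + zpart e :=: perppart e)%MS.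
Proof. exact/addsmx_diffK/rad_perppart. Qed.

Lemma span_e : (Sperp *m e + fpart e :=: e)%MS.
Proof. exact/addsmx_diffK/Sperp_sub. Qed.

Lemma fixC_radpart : (fixpart e' <= radpart e)%MS.
Proof.
have := submx_refl (fixpart e'); rewrite fixpartP radpartP => /andP[ES /eqP Ee].
have -> : fixpart e' *m e = 0.
  by rewrite -Ee -mulmxA mulmxBl mul1mx (proj1 se) subrr mulmx0.
by rewrite ES /mxortho !mul0mx eqxx.
Qed.

Lemma fix_sub_radpart : (fixpart e + fixpart e' <= radpart e)%MS.
Proof. by rewrite addsmx_sub fix_radpart fixC_radpart. Qed.

Lemma span_radpart : (fixpart e + fixpart e' + apart e :=: radpart e)%MS.
Proof. exact/addsmx_diffK/fix_sub_radpart. Qed.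

Lemma rank_apart :
  (\rank (apart e) + (\rank (fixpart e) + \rank (fixpart e')) = \rank (radpart e))%N.
Proof. by rewrite -rank_fixpart_sum; exact/rank_diffmx/fix_sub_radpart. Qed.

Lemma span_S : (radpart e + ypart e :=: S)%MS.
Proof. exact/addsmx_diffK/capmxSl. Qed.

Lemma rank_ypart : (\rank (ypart e) + \rank (radpart e) = \rank S)%N.
Proof. exact/rank_diffmx/capmxSl. Qed.

Lemma perp_sum_sub : (perppart e + perppart e' + S <= Sperp)%MS.
Proof. by rewrite !addsmx_sub !capmxSr S_Sperp. Qed.

Lemma span_Sperp : (perppart e + perppart e' + S + dpart e :=: Sperp)%MS.
Proof. exact/addsmx_diffK/perp_sum_sub. Qed.

Lemma fixpartM : fixpart e *m e = fixpart e.
Proof. by have := submx_refl (fixpart e); rewrite fixpartP => /andP[_ /eqP]. Qed.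

Lemma fixpartCM : fixpart e' *m e = 0.
Proof.
have := submx_refl (fixpart e'); rewrite fixpartP => /andP[_ /eqP <-].
by rewrite -mulmxA mulmxBl mul1mx (proj1 se) subrr mulmx0.
Qed.

Lemma perppartM : perppart e *m e = perppart e.
Proof. by have := submx_refl (perppart e); rewrite perppartP => /andP[/eqP]. Qed.

Lemma perppartCM : perppart e' *m e = 0.
Proof.
have : (perppart e' <= e')%MS by exact: capmxSl.
by rewrite (sub_idem _ (selfadj_idemC se)) => /eqP <-;
   rewrite -mulmxA mulmxBl mul1mx (proj1 se) subrr mulmx0.
Qed.

Lemma rank_dpart :
  (\rank (dpart e) + \rank (perppart e + perppart e' + S)%MS = \rank Sperp)%N.
Proof. exact/rank_diffmx/perp_sum_sub. Qed.

Section Spanning.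
Variables A Y D : 'M[R]_n.
Hypothesis spanA : (fixpart e + fixpart e' + A :=: radpart e)%MS.
Hypothesis spanY : (radpart e + Y :=: S)%MS.
Hypothesis spanD : (perppart e + perppart e' + S + D :=: Sperp)%MS.

Lemma radpartM : (radpart e *m e :=: fixpart e + A *m e)%MS.
Proof.
apply: eqmx_trans (eqmxMr e (eqmx_sym spanA)) _.
apply: eqmx_trans (addsmxMr _ _ _) (adds_eqmx _ (eqmx_refl _)).
apply: eqmx_trans (addsmxMr _ _ _) _.
by rewrite fixpartM fixpartCM; exact: addsmx0.
Qed.

Lemma SM : (S *m e :=: fixpart e + A *m e + Y *m e)%MS.
Proof.
apply: eqmx_trans (eqmxMr e (eqmx_sym spanY)) _.
exact: eqmx_trans (addsmxMr _ _ _) (adds_eqmx radpartM (eqmx_refl _)).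
Qed.

Lemma SperpM_sub :
  (Sperp *m e <= perppart e + S *m e + D *m e)%MS.
Proof.
rewrite -(eqmxMr e spanD) addsmxMr addsmx_sub addsmxSr andbT.
rewrite addsmxMr addsmx_sub (submx_trans (addsmxSr _ _) (addsmxSl _ _)) andbT.
rewrite addsmxMr perppartM perppartCM addsmx0.
exact: submx_trans (addsmxSl _ _) (addsmxSl _ _).
Qed.

Lemma perppart_sub : (perppart e <= fixpart e + A *m e + zpart e)%MS.
Proof.
rewrite -span_perppart addsmx_sub addsmxSr andbT radpartM; exact: addsmxSl.
Qed.

Lemma span_projection :
  (e <= fixpart e + A *m e + Y *m e + zpart e + D *m e +
        fpart e)%MS.
Proof.
rewrite -{1}span_e; apply: addsmxS => //.
apply: submx_trans SperpM_sub _; apply: addsmxS => //.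
rewrite addsmx_sub (submx_trans perppart_sub) ?SM ?addsmxSl //.
by apply: addsmxS => //; exact: addsmxSl.
Qed.

End Spanning.

End OneProjection.

(** A vector of [S] lies in the sum of the two perpendicular parts exactly when its component along
    [e] is orthogonal to [S], so that sum meets [S] in [radpart e]. This count yields the dimension
    of [dpart]. *)
Lemma rank_perp_sum e (se : selfadj_idem e) :
  (\rank (perppart e + perppart (1%:M - e)%R + S)%MS + \rank (radpart e) =
   \rank (perppart e) + \rank (perppart (1%:M - e)%R) + \rank S)%N.
Proof.
set e' := 1%:M - e.
have QQ0 : (perppart e :&: perppart e' = 0)%MS.
  set C := (_ :&: _)%MS; have := submx_refl C; rewrite {2}/C sub_capmx.
  move=> /andP[/submxP[D CD] /submxP[D' CD']].
  have Ce : C *m e = C by rewrite CD -mulmxA (perppartM se).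
  by rewrite -Ce CD' -mulmxA (perppartCM se) mulmx0.
rewrite -(mxrank_disjoint_sum QQ0) -[RHS]mxrank_sum_cap; congr (_ + _)%N.
apply/eqmx_rank/andP; split; last first.
  set C := (_ :&: _)%MS; have := submx_refl C; rewrite {2}/C sub_capmx.
  move=> /andP[CQ CS]; rewrite radpartP CS -sub_Sperp /=.
  apply: submx_trans (submxMr e CQ) _; rewrite addsmxMr (perppartM se) (perppartCM se).
  by rewrite addsmx0 capmxSr.
rewrite sub_capmx capmxSl andbT.
have -> : radpart e = radpart e *m e + radpart e *m e'.
  by rewrite -mulmxDr addrC subrK mulmx1.
apply: addmx_sub_adds; first exact: (rad_perppart se).
by rewrite (eqmxMr _ (eqmx_sym (radpartC e))); exact/rad_perppart/(selfadj_idemC se).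
Qed.

End AdaptedSubspaces.

(** * Upper bound for the Lie algebra of the stabilizer *)

Section StabilizerBound.
Variables (R : realType) (n : nat) (B S A Y D : 'M[R]_n).
Hypothesis symB : B^T = B.
Hypothesis uB : B \in unitmx.
Hypothesis isoS : S *m B *m S^T = 0.

(** [A], [Y] and [D] are parameters, not the complements built from [e], so that the same three
    matrices serve for [e] and for 1 - e. *)
Definition adapted e := [/\ selfadj_idem B e,
  (fixpart S e + fixpart S (1%:M - e) + A :=: radpart B S e)%MS,
  (radpart B S e + Y :=: S)%MS &
  (perppart B S e + perppart B S (1%:M - e) + S + D :=: Sperp B S)%MS].

Lemma adaptedC e : adapted e -> adapted (1%:M - e).
Proof.
move=> [se sA sY sD]; split; first exact: selfadj_idemC.
- rewrite idemC_id; apply: eqmx_trans (eqmx_sym (radpartC isoS e)).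
  by apply: eqmx_trans sA; rewrite [X in (X + A)%MS]addsmxC.
- apply: eqmx_trans sY; apply: adds_eqmx => //; exact: radpartC.
- by apply: eqmx_trans sD; rewrite idemC_id [X in (X + S + D)%MS]addsmxC.
Qed.

(** For s in S and t in U orthogonal to S, G(s e, t) = G(s, t) = 0; likewise S meet U pairs
    trivially with the projection of S^perp. Up to skewness this settles every block of U x U that
    is not among the hypotheses. *)
Lemma mxortho_block (G e : 'M[R]_n) : adapted e -> G + G^T = 0 ->
  e *m G = G *m e^T -> mxortho G S (Sperp B S) ->
  mxortho G (fpart B S e)
    (fixpart S e + A *m e + Y *m e + zpart B S e)%MS ->
  mxortho G (D *m e) (A *m e + Y *m e + zpart B S e)%MS ->
  mxortho G (Y *m e) (Y *m e) -> mxortho G (zpart B S e) (zpart B S e) ->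
  mxortho G (D *m e + fpart B S e)%MS (D *m e + fpart B S e)%MS ->
  mxortho G e e.
Proof.
move=> [se sA sY sD] Gskew eG SSp FR DR YY ZZ DD.
have symG m1 m2 (M : 'M[R]_(m1, n)) (N : 'M[R]_(m2, n)) :
  mxortho G M N = mxortho G N M by exact: mxortho_skewC.
have adj m1 m2 (M : 'M[R]_(m1, n)) (N : 'M[R]_(m2, n)) :
    mxortho G (M *m e) N = mxortho G M (N *m e).
  by rewrite /mxortho trmx_mul -(mulmxA M) eG !mulmxA.
have AS : (A <= S)%MS.
  rewrite -sY; apply: submx_trans (addsmxSl _ _); rewrite -sA; exact: addsmxSr.
have YS : (Y <= S)%MS by rewrite -sY; exact: addsmxSr.
have DS : (D <= Sperp B S)%MS by rewrite -sD; exact: addsmxSr.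
have SQ m1 m2 (M : 'M[R]_(m1, n)) (N : 'M[R]_(m2, n)) :
    (M <= S)%MS -> (N <= perppart B S e)%MS -> mxortho G (M *m e) N.
  move=> MS NQ; rewrite adj; move: NQ; rewrite perppartP //.
  move=> /andP[/eqP -> NS]; apply: mxortho_sub SSp => //.
  by rewrite sub_Sperp.
have ES m1 (M : 'M[R]_(m1, n)) :
    (M <= Sperp B S)%MS -> mxortho G (fixpart S e) (M *m e).
  move=> MS; rewrite -adj; have := submx_refl (fixpart S e).
  rewrite fixpartP => /andP[EleS /eqP ->]; exact: mxortho_sub SSp.
have EQ : (fixpart S e <= perppart B S e)%MS.
  have := submx_refl (fixpart S e); rewrite fixpartP perppartP // => /andP[EleS ->].
  by rewrite -sub_Sperp (submx_trans EleS) // S_Sperp.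
have AQ : (A *m e <= perppart B S e)%MS.
  apply: submx_trans (rad_perppart S se); apply: submxMr; rewrite -sA; exact: addsmxSr.
have ZQ : (zpart B S e <= perppart B S e)%MS by exact: diffmxSl.
have Ee : fixpart S e = fixpart S e *m e by rewrite fixpartM.
have Ze : zpart B S e = zpart B S e *m e.
  by have := ZQ; rewrite perppartP // => /andP[/eqP].
have ZS : (zpart B S e <= Sperp B S)%MS by apply: submx_trans ZQ (capmxSr _ _).
have EleS : (fixpart S e <= S)%MS by exact: capmxSl.
have SSp' := S_Sperp isoS.
have AES : (A <= Sperp B S)%MS by exact: submx_trans AS SSp'.
have YES : (Y <= Sperp B S)%MS by exact: submx_trans YS SSp'.
have EES : (fixpart S e <= Sperp B S)%MS by exact: submx_trans EleS SSp'.
have EE : mxortho G (fixpart S e) (fixpart S e) by rewrite {2}Ee ES.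
have EZ : mxortho G (fixpart S e) (zpart B S e) by rewrite Ze ES.
have EA := ES _ A AES; have EY := ES _ Y YES; have ED := ES _ D DS.
have AA := SQ _ _ _ _ AS AQ; have AZ := SQ _ _ _ _ AS ZQ.
have YA := SQ _ _ _ _ YS AQ; have YZ := SQ _ _ _ _ YS ZQ.
move: FR DR DD; rewrite !mxortho_addsl !mxortho_addsr.
move=> /andP[/andP[/andP[FE FA] FY] FZ] /andP[/andP[DA DY] DZ].
move=> /andP[/andP[DD DF] /andP[FD FF]].
have sp := span_projection se sA sY sD.
apply: (mxortho_sub sp sp); rewrite !mxortho_addsl !mxortho_addsr.
rewrite EE EZ EA EY ED AA AZ YA YZ FE FA FY FZ DA DY DZ DD DF FD FF YY ZZ /=.
rewrite (symG _ _ (A *m e) (fixpart S e)) EA (symG _ _ (Y *m e) (fixpart S e)) EY.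
rewrite (symG _ _ _ (fixpart S e)) EZ (symG _ _ (D *m e) (fixpart S e)) ED /=.
rewrite (symG _ _ _ (fpart B S e)) FE (symG _ _ (A *m e) (Y *m e)) YA.
rewrite (symG _ _ (A *m e) (D *m e)) DA (symG _ _ (A *m e) (fpart B S e)) FA.
rewrite (symG _ _ (Y *m e) (D *m e)) DY (symG _ _ (Y *m e) (fpart B S e)) FY.
rewrite (symG _ _ (zpart B S e) (A *m e)) AZ (symG _ _ (zpart B S e) (Y *m e)) YZ.
rewrite (symG _ _ (zpart B S e) (D *m e)) DZ.
by rewrite (symG _ _ (zpart B S e) (fpart B S e)) FZ.
Qed.

(** Since G commutes with e, G(M, N) is the sum of its U part and its W part. A pairing that
    vanishes on V and on U then vanishes on W, at no cost in parameters. *)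
Lemma mxortho_complement (G e : 'M[R]_n) m1 m2 (M : 'M[R]_(m1, n))
    (N : 'M[R]_(m2, n)) (e' := 1%:M - e) :
  e *m e = e -> e *m G = G *m e^T -> mxortho G M N ->
  mxortho G (M *m e) (N *m e) -> mxortho G (M *m e') (N *m e').
Proof.
move=> ee eG /eqP MN.
have compress f : f *m f = f -> f *m G = G *m f^T ->
    M *m f *m G *m (N *m f)^T = M *m (f *m G) *m N^T.
  move=> ff fG; rewrite trmx_mul !mulmxA -(mulmxA (M *m f) G) -fG.
  by rewrite mulmxA -(mulmxA M f f) ff.
rewrite /mxortho !compress //.
- by rewrite /e' mulmxBl mul1mx mulmxBr mulmxBl mulmxA MN sub0r oppr_eq0.
- by rewrite /e' mulmxBl mul1mx mulmxBr mulmx1 ee subrr subr0.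
- by rewrite /e' linearB /= trmx1 mulmxBl mulmxBr mul1mx mulmx1 eG.
Qed.

(** One summand per imposed block of X B, five on the U side and four on the W side. On W the blocks
    D x A, D x Y and Y x Y are missing because [mxortho_complement] deduces them from those on U. *)
Lemma stab_dim_le e (e' := 1%:M - e) : adapted e -> dim_le
  (fun X => [/\ X *m B + B *m X^T = 0, e *m X = X *m e & (S *m X <= S)%MS])
  (\rank (fpart B S e) *
     \rank (fixpart S e + A *m e + Y *m e + zpart B S e)%MS +
   (\rank (D *m e) * \rank (A *m e + Y *m e + zpart B S e)%MS +
   ('C(\rank (Y *m e), 2) + ('C(\rank (zpart B S e), 2) +
   ('C(\rank (D *m e + fpart B S e)%MS, 2) +
   (\rank (fpart B S e') *
     \rank (fixpart S e' + A *m e' + Y *m e' + zpart B S e')%MS +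
   (\rank (D *m e') * \rank (zpart B S e') + ('C(\rank (zpart B S e'), 2) +
   ('C(\rank (D *m e' + fpart B S e')%MS, 2) + 0))))))))).
Proof.
move=> ade; have ade' := adaptedC ade.
have [[ee eB] sA sY sD] := ade.
have sk X (M : 'M[R]_n) : X *m B + B *m X^T = 0 ->
    M *m (X *m B) *m M^T + (M *m (X *m B) *m M^T)^T = 0.
  move=> XB; rewrite [(M *m _ *m _)^T]trmx_mul trmxK trmx_mul [(X *m B)^T]trmx_mul symB.
  by rewrite (mulmxA M (B *m X^T)) -mulmxDl -mulmxDr XB mulmx0 mul0mx.
apply: (dim_le_ortho (C := B)); apply: (dim_le_ortho (C := B)).
apply: (dim_le_skew (C := B)) => [X [[[XB _ _] _] _]|]; first exact: sk.
apply: (dim_le_skew (C := B)) => [X [[[[XB _ _] _] _] _]|]; first exact: sk.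
apply: (dim_le_skew (C := B)) => [X [[[[[XB _ _] _] _] _] _]|]; first exact: sk.
apply: (dim_le_ortho (C := B)); apply: (dim_le_ortho (C := B)).
apply: (dim_le_skew (C := B)) => [X [[[[[[[[XB _ _] _] _] _] _] _] _] _]|].
  exact: sk.
apply: (dim_le_skew (C := B)) => [X [[[[[[[[[XB _ _] _] _] _] _] _] _] _] _]|].
  exact: sk.
apply: dim_le0 => X.
move=> [[[[[[[[[[XB eX SX] FR] DR] YY] ZZ] DD] FR'] DZ'] ZZ'] DD'].
have Gskew : X *m B + (X *m B)^T = 0 by rewrite trmx_mul symB.
have eG : e *m (X *m B) = X *m B *m e^T by rewrite mulmxA eX -(mulmxA X e) eB mulmxA.
(* Stability of [S] in terms of the form: the image of [S] under [X] is again orthogonal to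
   S^perp. *)
have SSp : mxortho (X *m B) S (Sperp B S).
  have /submxP[T ST] := SX; have := submx_refl (Sperp B S).
  rewrite sub_Sperp mxortho_sym // /mxortho mulmxA ST => /eqP SSp.
  by rewrite -(mulmxA T S) -(mulmxA T (S *m B)) SSp mulmx0.
move: (X *m B) (mulmxK uB X) SSp Gskew eG FR DR YY ZZ DD FR' DZ' ZZ' DD'.
move=> G GX SSp Gskew eG FR DR YY ZZ DD FR' DZ' ZZ' DD'.
have G1 := mxortho_block ade Gskew eG SSp FR DR YY ZZ DD.
have AS : (A <= S)%MS.
  rewrite -sY; apply: submx_trans (addsmxSl _ _); rewrite -sA; exact: addsmxSr.
have YS : (Y <= S)%MS by rewrite -sY; exact: addsmxSr.
have DS : (D <= Sperp B S)%MS by rewrite -sD; exact: addsmxSr.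
have eG' : e' *m G = G *m e'^T.
  by rewrite linearB /= trmx1 mulmxBl mulmxBr mul1mx mulmx1 eG.
have symG m1 m2 (M : 'M[R]_(m1, n)) (N : 'M[R]_(m2, n)) :
  mxortho G M N = mxortho G N M by exact: mxortho_skewC.
move: (DR); rewrite !mxortho_addsr => /andP[/andP[DA DY] _].
have YSp : (Y <= Sperp B S)%MS := submx_trans YS (S_Sperp isoS).
have DA' : mxortho G (D *m e') (A *m e').
  by apply: mxortho_complement => //; rewrite symG; exact: mxortho_sub SSp.
have DY' : mxortho G (D *m e') (Y *m e').
  by apply: mxortho_complement => //; rewrite symG; exact: mxortho_sub SSp.
have YY' : mxortho G (Y *m e') (Y *m e').
  by apply: mxortho_complement => //; exact: mxortho_sub SSp.
have DR' : mxortho G (D *m e') (A *m e' + Y *m e' + zpart B S e')%MS.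
  by rewrite !mxortho_addsr DA' DY' DZ'.
have G2 := mxortho_block ade' Gskew eG' SSp FR' DR' YY' ZZ' DD'.
have G0 : G = e *m G *m e^T + e' *m G *m e'^T.
  rewrite eG eG' -!mulmxA -!trmx_mul ee (proj1 (selfadj_idemC (conj ee eB))).
  by rewrite -mulmxDr -linearD /= addrC subrK trmx1 mulmx1.
by rewrite -GX G0 (eqP G1) (eqP G2) addr0 mul0mx.
Qed.

End StabilizerBound.

(** * Upper bound for the tangent vectors of an orbit *)

Section TangentBound.
Variables (R : realType) (n : nat) (B P A Y D e : 'M[R]_n).
Hypothesis symB : B^T = B.
Hypothesis uB : B \in unitmx.
Hypothesis isoP : P *m B *m P^T = 0.
Hypothesis Psym : P^T = P.
Hypothesis PP : P *m P = P.
Local Notation e' := (1%:M - e).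
Local Notation E := (fixpart P e).
Local Notation E' := (fixpart P e').
Local Notation Z := (zpart B P e).
Local Notation Z' := (zpart B P e').

Lemma SperpK : (Sperp B (Sperp B P) :=: P)%MS.
Proof.
apply/eqmx_sym/eqmxP.
have sub : (P <= Sperp B (Sperp B P))%MS.
  by rewrite sub_Sperp mxortho_sym // -sub_Sperp.
have [_ <-] := mxrank_leqif_eq sub.
rewrite -(eqn_add2l (\rank (Sperp B P))) (rank_Sperp P uB) addnC.
by rewrite (rank_Sperp (Sperp B P) uB).
Qed.

(** The blocks are those of the form B(s Q, t) on S x S^perp: rows of S are taken in the order E,
    E', A, Y, and each is counted only against what skewness and the rank conditions leave free. *)
Lemma tangent_dim_le : adapted B P A Y D e -> dim_le (orbit_tangent B e P)
  ('C(\rank E, 2) + (\rank E * \rank (A *m e + Y + Z + D)%MS +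
  ('C(\rank E', 2) + (\rank E' * \rank (A *m e' + Y + Z' + D)%MS +
  ('C(\rank A, 2) + ('C(\rank A, 2) +
  (\rank A * \rank (Y + Z + Z' + D)%MS +
  ('C(\rank Y, 2) + (\rank Y * \rank (A *m e + Z + Z' + D)%MS + 0))))))))).
Proof.
move=> ade; have ade' := adaptedC isoP ade.
have [se sA sY sD] := ade; have [ee eB] := se; have [se' _ _ _] := ade'.
have EP : (E <= P)%MS by exact: capmxSl.
have EP' : (E' <= P)%MS by exact: capmxSl.
have YP : (Y <= P)%MS by rewrite -sY; exact: addsmxSr.
have AR : (A <= radpart B P e)%MS by rewrite -sA; exact: addsmxSr.
have AP : (A <= P)%MS by exact: submx_trans AR (capmxSl _ _).
have sk (M Q : 'M[R]_n) : (M <= P)%MS -> orbit_tangent B e P Q ->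
    M *m (Q *m B) *m M^T + (M *m (Q *m B) *m M^T)^T = 0.
  move=> /submxP[T ->] [[_ _ PQ] _].
  have := congr1 (fun X => T *m X *m T^T) PQ.
  rewrite mulmx0 mul0mx mulmxDr mulmxDl => <-.
  by rewrite !trmx_mul !trmxK !mulmxA.
(* Constancy of the rank of the Gram matrix makes (s, t) |-> B(s Q, t e) skew on [A], and by
   subtraction also its analogue for 1 - e. The pairings of A with A e and A e' therefore cost two
   skew blocks. *)
have skA Q : orbit_tangent B e P Q ->
    A *m (Q *m (B *m e^T)) *m A^T + (A *m (Q *m (B *m e^T)) *m A^T)^T = 0.
  move=> [_ [_ _ T4]]; move: AR; rewrite radpartP => /andP[_ /eqP AB].
  by have := T4 _ _ _ _ AP AP AB AB; rewrite [(A *m e)^T]trmx_mul !mulmxA.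
have skA' Q : orbit_tangent B e P Q ->
    A *m (Q *m (B *m e'^T)) *m A^T + (A *m (Q *m (B *m e'^T)) *m A^T)^T = 0.
  move=> TQ; have := sk A Q AP TQ; have := skA Q TQ.
  move=> H1 H2.
  have -> : A *m (Q *m (B *m e'^T)) *m A^T =
      A *m (Q *m B) *m A^T - A *m (Q *m (B *m e^T)) *m A^T.
    by rewrite raddfB /= trmx1 !mulmxBr mulmx1 mulmxBl.
  by rewrite raddfB /= addrACA H2 -opprD H1 subr0.
apply: (dim_le_skew (C := B)) => [Q|]; first exact: sk.
apply: (dim_le_ortho (C := B)).
apply: (dim_le_skew (C := B)) => [Q [[TQ _] _]|]; first exact: sk.
apply: (dim_le_ortho (C := B)).
apply: (dim_le_skew (C := B *m e^T)) => [Q [[[[TQ _] _] _] _]|].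
  exact: skA.
apply: (dim_le_skew (C := B *m e'^T)) => [Q [[[[[TQ _] _] _] _] _]|].
  exact: skA'.
apply: (dim_le_ortho (C := B)).
apply: (dim_le_skew (C := B)) => [Q [[[[[[[TQ _] _] _] _] _] _] _]|].
  exact: sk.
apply: (dim_le_ortho (C := B)); apply: dim_le0 => Q.
move=> [[[[[[[[[TQ EE] ER] EE'] ER'] AA] AA'] AYZD] YY] YAZD].
have [[Qsym QP _] [T2 T3 _]] := TQ.
have symG (M N : 'M[R]_n) : (M <= P)%MS -> (N <= P)%MS ->
    mxortho (Q *m B) M N = mxortho (Q *m B) N M.
  move=> /submxP[T ->] /submxP[T' ->]; have [[_ _ PQ] _] := TQ.
  have XE V V' : mxortho (Q *m B) (V *m P) (V' *m P) =
      mxortho (P *m Q *m B *m P^T) V V'.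
    by rewrite /mxortho trmx_mul !mulmxA.
  by rewrite !XE mxortho_skewC.
(* Then P Q maps into the double orthogonal of [P], which is [P]; since P Q P = 0 by the equation Q
   P + P Q = Q, this gives P Q = 0, and Q = Q P = (P Q)^T = 0 by symmetry. *)
suff PSp : mxortho (Q *m B) P (Sperp B P).
  have /submxP[T PQ] : (P *m Q <= P)%MS.
    have : (P *m Q <= Sperp B (Sperp B P))%MS.
      by rewrite sub_Sperp /mxortho -(mulmxA P).
    by rewrite SperpK.
  have PQP : P *m Q *m P = 0.
    have := congr1 (mulmx P) QP; rewrite mulmxDr !mulmxA PP => /eqP.
    by rewrite -subr_eq0 addrK => /eqP.
  have PQ0 : P *m Q = 0 by rewrite -PQP PQ -mulmxA PP.
  by rewrite -QP PQ0 addr0 -[LHS]trmxK trmx_mul Qsym Psym PQ0 trmx0.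
move: ER ER' AYZD YAZD; rewrite !mxortho_addsr.
move=> /andP[/andP[/andP[EA EY] EZ] ED] /andP[/andP[/andP[EA' EY'] EZ'] ED'].
move=> /andP[/andP[/andP[AY AZ] AZ'] AD] /andP[/andP[/andP[YA YZ] YZ'] YD].
have sub_Sp m (M : 'M[R]_(m, n)) : (M <= Sperp B P)%MS -> M *m B *m P^T = 0.
  by rewrite sub_Sperp => /eqP.
have Ee : E *m e = E := fixpartM P e.
have Ee' : E' *m e = 0 := fixpartCM P se.
have QS f : (perppart B P f <= Sperp B P)%MS by exact: capmxSr.
have ZQ f : (zpart B P f <= perppart B P f)%MS by exact: diffmxSl.
have AeQ : (A *m e <= perppart B P e)%MS.
  by apply: submx_trans (rad_perppart P se); exact: submxMr.
have AeQ' : (A *m e' <= perppart B P e')%MS.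
  apply: submx_trans (rad_perppart P se'); apply: submxMr.
  by rewrite (radpartC isoP).
have Qe m (M : 'M[R]_(m, n)) : (M <= perppart B P e)%MS -> M *m e = M.
  by rewrite perppartP // => /andP[/eqP].
have Qe' m (M : 'M[R]_(m, n)) : (M <= perppart B P e')%MS -> M *m e = 0.
  by move=> /submxP[T ->]; rewrite -mulmxA (perppartCM P se) mulmx0.
(* The rank conditions on P e and P (1 - e): S meet U is paired freely with neither A e' nor Z', and
   S meet W with neither A e nor Z. *)
have EQ' m (N : 'M[R]_(m, n)) : (N <= perppart B P e')%MS -> mxortho (Q *m B) E N.
  move=> NQ; apply/eqP; rewrite mulmxA.
  by apply: T3 => //; [exact/sub_Sp/(submx_trans NQ)|exact: Qe'].
have E'Q m (N : 'M[R]_(m, n)) : (N <= perppart B P e)%MS -> mxortho (Q *m B) E' N.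
  move=> NQ; apply/eqP; rewrite mulmxA.
  by apply: T2 => //; [exact/sub_Sp/(submx_trans NQ)|exact: Qe].
have split_A : (A <= A *m e + A *m e')%MS.
  have AE : A = A *m e + A *m e' by rewrite -mulmxDr addrC subrK mulmx1.
  by rewrite {1}AE; exact: addmx_sub_adds.
have split_A' : (A *m e' <= A + A *m e)%MS.
  by rewrite mulmxBr mulmx1; apply: addmx_sub_adds; rewrite ?eqmx_opp.
have AAe : mxortho (Q *m B) A (A *m e).
  by move: AA; rewrite /mxortho trmx_mul !mulmxA.
have AAe' : mxortho (Q *m B) A (A *m e').
  by move: AA'; rewrite /mxortho trmx_mul !mulmxA.
have EAe' := EQ' _ _ AeQ'; have E'Ae := E'Q _ _ AeQ.
have EZ'' := EQ' _ _ (ZQ e'); have E'Z := E'Q _ _ (ZQ e).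
have EE'' : mxortho (Q *m B) E E'.
  apply: EQ'; rewrite perppartP // fixpartM eqxx /=.
  by rewrite -sub_Sperp (submx_trans EP') ?S_Sperp.
have E'E : mxortho (Q *m B) E' E.
  apply: E'Q; rewrite perppartP // fixpartM eqxx /=.
  by rewrite -sub_Sperp (submx_trans EP) ?S_Sperp.
have EA1 : mxortho (Q *m B) E A.
  by apply: mxortho_sub (submx_refl _) split_A _; rewrite mxortho_addsr EA.
have EA1' : mxortho (Q *m B) E' A.
  by apply: mxortho_sub (submx_refl _) split_A _; rewrite mxortho_addsr E'Ae.
have YAe' : mxortho (Q *m B) Y (A *m e').
  apply: mxortho_sub (submx_refl _) split_A' _.
  by rewrite mxortho_addsr YA andbT symG.
have spP : (P <= E + E' + A + Y)%MS.
  by rewrite -{1}sY; apply: addsmxS => //; rewrite sA.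
have spSp : (Sperp B P <=
    (E + A *m e + Z) + (E' + A *m e' + Z') + (E + E' + A + Y) + D)%MS.
  rewrite -sD; apply: addsmxS => //; apply: addsmxS => //; apply: addsmxS.
    exact: (perppart_sub se sA).
  by have [_ sA' _ _] := ade'; exact: (perppart_sub se' sA').
apply: (mxortho_sub spP spSp); rewrite !mxortho_addsl !mxortho_addsr.
rewrite EE EA EZ EE'' EAe' EZ'' EA1 EY ED EE' EA' EZ' E'E E'Ae E'Z EA1' EY' ED' /=.
rewrite (symG A E) // EA1 (symG A E') // EA1' AAe AAe' AZ AZ' AY AD /=.
have AA1 : mxortho (Q *m B) A A.
  by apply: mxortho_sub (submx_refl _) split_A _; rewrite mxortho_addsr AAe.
rewrite AA1 (symG Y E) // EY (symG Y E') // EY' (symG Y A) // AY.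
by rewrite YA YZ YAe' YZ' YY YD.
Qed.

End TangentBound.

(** * Dimension of the isometry algebra of an orthogonal sum *)

Section IsometryAlgebraDimension.
Variable R : realType.

Definition upper_mx m (v : 'rV[R]_#|{: {x : 'I_m * 'I_m | (x.1 < x.2)%N}}|) :
    'M[R]_m :=
  \matrix_(i, j) oapp (fun t => v 0 (enum_rank t)) 0
    (insub (i, j) : option {x : 'I_m * 'I_m | (x.1 < x.2)%N}).

Definition skew_mx m v : 'M[R]_m := upper_mx v - (upper_mx v)^T.

Lemma skew_mx_linear m : linear (@skew_mx m).
Proof.
move=> a v w; rewrite /skew_mx.
have -> : upper_mx (a *: v + w) = a *: upper_mx v + upper_mx w.
  by apply/matrixP => i j; rewrite !mxE; case: insub => [t|] /=;
     rewrite ?mxE ?mulr0 ?addr0.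
by rewrite linearP /= opprD addrACA scalerBr.
Qed.

Lemma skew_mx_inj m v : @skew_mx m v = 0 -> v = 0.
Proof.
move=> /matrixP v0; apply/rowP => k; rewrite mxE -(enum_valK k).
case: (enum_val k) => -[i j] /= ij; have := v0 i j; rewrite !mxE.
rewrite insubT /= [insub (j, i)]insubF ?subr0 //=.
by apply/negbTE; rewrite -leqNgt ltnW.
Qed.

Lemma skew_mx_skew m v : @skew_mx m v + (skew_mx v)^T = 0.
Proof. by rewrite /skew_mx linearB /= trmxK addrA subrK subrr. Qed.

Section Bound.
Variables (n : nat) (B : 'M[R]_n).
Hypothesis symB : B^T = B.
Hypothesis uB : B \in unitmx.

(** The solution X of X B = A^T K A with K skew; membership in the isometry algebra means precisely
    that X B is skew. Rows [A] fixed by e^T confine X to the image of [e]. *)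
Definition skew_part m (A : 'M[R]_(m, n)) v : 'M[R]_n :=
  A^T *m @skew_mx m v *m A *m invmx B.

Lemma skew_part_linear m (A : 'M[R]_(m, n)) : linear (skew_part A).
Proof.
move=> a v w; rewrite /skew_part skew_mx_linear mulmxDr !mulmxDl.
by rewrite -scalemxAr -!scalemxAl.
Qed.

Lemma skew_part_inj m (A : 'M[R]_(m, n)) v :
  row_free A -> skew_part A v = 0 -> v = 0.
Proof.
move=> /row_freeP[C AC1] /(congr1 (mulmxr B)) /=.
rewrite /skew_part mul0mx mulmxKV // => E.
apply: skew_mx_inj; have := congr1 (fun X => C^T *m X *m C) E.
rewrite mulmx0 mul0mx !mulmxA -trmx_mul -(mulmxA _ A C).
by rewrite AC1 trmx1 mul1mx mulmx1.
Qed.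

Lemma skew_part_isometry m (A : 'M[R]_(m, n)) v :
  skew_part A v *m B + B *m (skew_part A v)^T = 0.
Proof.
rewrite /skew_part mulmxKV // !trmx_mul trmxK trmx_inv symB mulKVmx //.
by rewrite mulmxA -mulmxDl -mulmxDr skew_mx_skew mulmx0 mul0mx.
Qed.

Lemma skew_part_l m (A : 'M[R]_(m, n)) e v :
  A *m e^T = A -> e *m skew_part A v = skew_part A v.
Proof.
by move=> Ae; rewrite /skew_part !mulmxA -{1}[e]trmxK -trmx_mul Ae.
Qed.

Lemma skew_part_r m (A : 'M[R]_(m, n)) e v :
  selfadj_idem B e -> A *m e^T = A -> skew_part A v *m e = skew_part A v.
Proof.
move=> [ee eB] Ae.
have Be : invmx B *m e = e^T *m invmx B.
  by apply: (can_inj (mulmxK uB)); rewrite /= mulmxKV // -mulmxA eB mulKmx.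
by rewrite /skew_part -(mulmxA _ (invmx B)) Be mulmxA -(mulmxA _ A e^T) Ae.
Qed.

Lemma row_base_tr_idem (e : 'M[R]_n) :
  e *m e = e -> row_base e^T *m e^T = row_base e^T.
Proof.
move=> ee; have /submxP[T ->] : (row_base e^T <= e^T)%MS by rewrite eq_row_base.
by rewrite -mulmxA -trmx_mul ee.
Qed.

(** Row bases of e^T and (1 - e)^T give two families of skew parts, and multiplication by [e] kills
    the second while fixing the first, so they are independent. *)
Lemma isometry_algebra_dim_ge e (L : {vspace 'M[R]_n}) : selfadj_idem B e ->
  (forall X, X *m B + B *m X^T = 0 -> e *m X = X *m e -> X \in L) ->
  ('C(\rank e, 2) + 'C(\rank (1%:M - e)%R, 2) <= \dim L)%N.
Proof.
move=> se LP; have se' := selfadj_idemC se; set e' := 1%:M - e in se' *.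
have [ee _] := se; have ee' : e *m e' = 0 by rewrite mulmxBr mulmx1 ee subrr.
have e'e : e' *m e = 0 by rewrite mulmxBl mul1mx ee subrr.
have A1 := row_base_tr_idem ee; have A1' := row_base_tr_idem (proj1 se').
have A2 := row_base_free e^T; have A2' := row_base_free e'^T.
rewrite -(mxrank_tr e) -(mxrank_tr e') -!card_ltn_pairs.
move: (\rank e^T) (\rank e'^T) (row_base e^T) (row_base e'^T) A1 A1' A2 A2'.
move=> m m' A A' A1 A1' A2 A2'.
have l v := skew_part_l v A1; have r v := skew_part_r v se A1.
have l' v : e *m skew_part A' v = 0.
  by rewrite -(skew_part_l v A1') mulmxA ee' mul0mx.
have r' v : skew_part A' v *m e = 0.
  by rewrite -(skew_part_r v se' A1') -mulmxA e'e mulmx0.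
pose f v := skew_part A (lsubmx v) + skew_part A' (rsubmx v).
have fl : linear f.
  move=> a v w; rewrite /f (linearP lsubmx) (linearP rsubmx).
  by rewrite !skew_part_linear scalerDr addrACA.
apply: (@injective_dimv _ _ _ _ _ f) => // [v w|v]; last first.
  apply: LP.
    by rewrite mulmxDl raddfD /= mulmxDr addrACA !skew_part_isometry addr0.
  by rewrite mulmxDl mulmxDr l r l' r'.
move=> vw; apply/subr0_eq.
have fvw : f (v - w) = 0 by rewrite addrC -scaleN1r fl vw scaleN1r addrC subrr.
have lv : skew_part A (lsubmx (v - w)) = 0.
  by have := congr1 (mulmx e) fvw; rewrite mulmx0 mulmxDr l l' addr0.
have rv : skew_part A' (rsubmx (v - w)) = 0 by move: fvw; rewrite /f lv add0r.
by rewrite -[v - w]hsubmxK (skew_part_inj A2 lv) (skew_part_inj A2' rv) row_mx0.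
Qed.

End Bound.
End IsometryAlgebraDimension.

(** * Signatures *)

Section Indices.
Variables (R : realType) (n : nat).
Implicit Types (B X D : 'M[R]_n).

Lemma formN B (v w : 'rV[R]_n) :
  (v *m (- B) *m w^T) 0 0 = - (v *m B *m w^T) 0 0.
Proof. by rewrite mulmxN mulNmx mxE. Qed.

Lemma negdefE B D : negdef B D <-> posdef (- B) D.
Proof.
by split=> H v vD v0; move: (H v vD v0); rewrite formN oppr_gt0.
Qed.

Lemma neg_indexE B X : neg_index B X = pos_index (- B) X.
Proof.
apply: eq_bigl => k; apply/asboolP/asboolP => -[D [DX dD rD]]; exists D.
  by split=> //; apply/negdefE.
by split=> //; apply/negdefE.
Qed.

Lemma pos_index_ge B X D : (D <= X)%MS -> posdef B D ->
  (\rank D <= pos_index B X)%N.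
Proof.
move=> DX pD; have rD : (\rank D < n.+1)%N by rewrite ltnS rank_leq_row.
apply: (@leq_bigmax_cond _ _ (fun k : 'I_n.+1 => k : nat) (Ordinal rD)).
by apply/asboolP; exists D.
Qed.

(** The zero subspace contributes k = 0, so the maximum is over a nonempty range and comes from an
    actual subspace. *)
Lemma pos_index_attained B X :
  exists D, [/\ (D <= X)%MS, posdef B D & \rank D = pos_index B X].
Proof.
have P0 : `[< exists D, [/\ (D <= X)%MS, posdef B D & \rank D = @ord0 n] >].
  apply/asboolP; exists 0; split; rewrite ?sub0mx ?mxrank0 // => v.
  by rewrite submx0 => /eqP ->; rewrite eqxx.
rewrite /pos_index (bigop.bigmax_eq_arg ord0) //.
by case: arg_maxnP => // k /asboolP[D ?] _; exists D.
Qed.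

Section Form.
Variable B : 'M[R]_n.
Hypothesis symB : B^T = B.
Local Notation b v w := ((v *m B *m w^T) 0 0).

Lemma form_sym (v w : 'rV[R]_n) : b v w = b w v.
Proof.
have -> : v *m B *m w^T = (w *m B *m v^T)^T.
  by rewrite !trmx_mul trmxK symB mulmxA.
by rewrite mxE.
Qed.

Lemma form_add (v w : 'rV[R]_n) : b (v + w) (v + w) = b v v + 2 * b v w + b w w.
Proof.
rewrite linearD /= mulmxDl mulmxDr !mulmxDl [X in X = _]mxE.
rewrite [X in X + _ = _]mxE [X in _ + X = _]mxE (form_sym w v).
by ring.
Qed.

Lemma form_scale (v : 'rV[R]_n) a : b (a *: v) (a *: v) = a ^+ 2 * b v v.
Proof.
by rewrite linearZ /= -!scalemxAl -scalemxAr scalerA mxE expr2.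
Qed.

Lemma form_scalel (v w : 'rV[R]_n) a : b (a *: v) w = a * b v w.
Proof. by rewrite -!scalemxAl mxE. Qed.

Lemma sub_Rad m (M : 'M[R]_(m, n)) X :
  (M <= Rad B X)%MS = (M <= X)%MS && (M *m B *m X^T == 0).
Proof. by rewrite sub_capmx sub_kermx mulmxA. Qed.

Lemma perp_row m (M : 'M[R]_(m, n)) X (v w : 'rV[R]_n) :
  M *m B *m X^T = 0 -> (v <= M)%MS -> (w <= X)%MS -> b v w = 0.
Proof.
move=> MX /submxP[D ->] /submxP[D' ->].
by rewrite trmx_mul !mulmxA -(mulmxA D) -(mulmxA D) MX mulmx0 mul0mx mxE.
Qed.

Lemma posdef_cap0 D (Y : 'M[R]_n) : posdef B D ->
  (forall v : 'rV_n, (v <= Y)%MS -> b v v <= 0) -> (D :&: Y = 0)%MS.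
Proof.
move=> pD nY; apply/eqP; rewrite -submx0; apply/rV_subP => v.
rewrite sub_capmx => /andP[vD vY]; rewrite submx0; apply/negPn/negP => v0.
by have := pD v vD v0; rewrite ltNge nY.
Qed.
End Form.

(** The form is at most 0 on the sum of a negative definite subspace and the radical, so this sum
    meets a positive definite subspace trivially. *)
Lemma index_sum_le B X : B^T = B ->
  (pos_index B X + neg_index B X + \rank (Rad B X) <= \rank X)%N.
Proof.
move=> symB; rewrite neg_indexE.
have [D [DX pD <-]] := pos_index_attained B X.
have [D' [DX' nD <-]] := pos_index_attained (- B) X.
have Rad_null m (M : 'M[R]_(m, n)) : (M <= Rad B X)%MS -> M *m B *m X^T = 0.
  by rewrite sub_Rad => /andP[_ /eqP].
have RX : (Rad B X <= X)%MS by exact: capmxSl.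
have D'R : (D' :&: Rad B X = 0)%MS.
  apply: (posdef_cap0 nD) => v vR; rewrite formN.
  by rewrite (perp_row (Rad_null _ _ (submx_refl _)) vR (submx_trans vR RX)) oppr0.
have DR : (D :&: (D' + Rad B X)%MS = 0)%MS.
  apply: (posdef_cap0 pD) => v /sub_addsmxP[[x y] ->] /=.
  set d := x *m D'; set k := y *m _.
  have kR : (k <= Rad B X)%MS by exact: submxMl.
  have dD : (d <= D')%MS by exact: submxMl.
  have kX (w : 'rV_n) : (w <= X)%MS -> (k *m B *m w^T) 0 0 = 0.
    by move=> wX; exact: perp_row (Rad_null _ _ (submx_refl _)) kR wX.
  rewrite form_add // (form_sym symB d) !kX ?(submx_trans kR) ?(submx_trans dD) //.
  rewrite mulr0 !addr0; have [->|d0] := eqVneq d 0; first by rewrite !mul0mx mxE.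
  by have := nD d dD d0; rewrite formN oppr_gt0 => /ltW.
rewrite -addnA -(mxrank_disjoint_sum D'R) -(mxrank_disjoint_sum DR).
by apply: mxrankS; rewrite !addsmx_sub DX DX' RX.
Qed.

(** By maximality of [D] the form is at most 0 on its orthogonal [Y] in [X]. Isotropic vectors of
    [Y] are then radical, so a complement of the radical in [Y] is negative definite. *)
Lemma index_sum_ge B X : B^T = B ->
  (\rank X <= pos_index B X + neg_index B X + \rank (Rad B X))%N.
Proof.
move=> symB; have [D [DX pD rD]] := pos_index_attained B X.
pose Y := (X :&: kermx (B *m D^T))%MS.
have YX : (Y <= X)%MS by exact: capmxSl.
have YD : Y *m B *m D^T = 0.
  by rewrite -mulmxA; apply/eqP; rewrite -sub_kermx capmxSr.
have nY (v : 'rV_n) : (v <= Y)%MS -> (v *m B *m v^T) 0 0 <= 0.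
  move=> vY; rewrite leNgt; apply/negP => qv.
  have vD0 (d : 'rV_n) : (d <= D)%MS -> (v *m B *m d^T) 0 0 = 0.
    by move=> dD; exact: perp_row YD vY dD.
  have pDv : posdef B (D + v)%MS.
    move=> w /sub_addsmxP[[x y] /= ->].
    set d := x *m D; have dD : (d <= D)%MS by exact: submxMl.
    rewrite [y]mx11_scalar mul_scalar_mx; set c := y 0 0 => w0.
    rewrite addrC form_add // form_scale form_scalel (vD0 d dD).
    rewrite !mulr0 addr0; have [d0|d0] := eqVneq d 0.
      have -> : (d *m B *m d^T) 0 0 = 0 by rewrite d0 !mul0mx mxE.
      rewrite addr0 mulr_gt0 // exprn_even_gt0 //=.
      by apply: contraNneq w0 => ->; rewrite d0 scale0r addr0.
    by rewrite ltr_wpDl ?pD // mulr_ge0 ?sqr_ge0 // ltW.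
  have := pos_index_ge (_ : (D + v <= X)%MS) pDv.
  rewrite -rD addsmx_sub DX (submx_trans vY YX) => /(_ isT).
  have [rle /esym] := mxrank_leqif_sup (addsmxSl D v).
  rewrite addsmx_sub submx_refl /= => E rle'.
  have : (v <= D)%MS by rewrite E eqn_leq rle rle'.
  by move=> /vD0 q0; rewrite q0 ltxx in qv.
have DY0 : (D :&: Y = 0)%MS by exact: posdef_cap0 pD nY.
have rY : (\rank X <= \rank D + \rank Y)%N.
  rewrite -(mxrank_mul_ker X (B *m D^T)) leq_add2r.
  by rewrite mulmxA -(mxrank_tr D) mxrankM_maxr.
have XDY : (X <= D + Y)%MS.
  have sub : (D + Y <= X)%MS by rewrite addsmx_sub DX YX.
  have [_ <-] := mxrank_leqif_sup sub.
  by rewrite eqn_leq mxrankS //= mxrank_disjoint_sum.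
have null (v : 'rV_n) : (v <= Y)%MS -> (v *m B *m v^T) 0 0 = 0 -> (v <= Rad B X)%MS.
  move=> vY qv.
  have vw (w : 'rV_n) : (w <= Y)%MS -> (v *m B *m w^T) 0 0 = 0.
    move=> wY; set c := (X in X = 0); set q := (w *m B *m w^T) 0 0.
    (* The affine function t |-> 2 t c + q is bounded above by 0, so c = 0; otherwise t = (1 - q) /
       (2 c) would give the value 1. *)
    have q_le t : 2 * t * c + q <= 0.
      have /nY : ((t *: v + w)%R <= Y)%MS by rewrite addmx_sub ?scalemx_sub.
      rewrite form_add // form_scale qv mulr0 add0r form_scalel -/c -/q.
      by rewrite mulrA.
    apply/eqP/negPn/negP => c0.
    have := q_le ((1 - q) / (2 * c)).
    by rewrite (_ : 2 * _ * c + q = 1) ?ler10 //; field; rewrite c0.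
  rewrite sub_Rad (submx_trans vY YX) /=; apply/eqP/rowP => i.
  transitivity ((v *m B *m (row i X)^T) 0 0).
    have -> : v *m B *m X^T = (X *m B *m v^T)^T.
      by rewrite !trmx_mul trmxK symB mulmxA.
    by rewrite form_sym // -!row_mul !mxE.
  have /sub_addsmxP[[x y] -> /=] := submx_trans (row_sub i X) XDY.
  rewrite raddfD /= mulmxDr mxE (vw (y *m Y)) ?submxMl // addr0.
  by rewrite (perp_row YD vY) ?submxMl // mxE.
have nD : posdef (- B) (Y :\: Rad B X)%MS.
  move=> v vD v0; rewrite formN oppr_gt0 lt_neqAle nY ?andbT; last first.
    exact: submx_trans vD (diffmxSl _ _).
  apply: contraNneq v0 => q0; rewrite -submx0 -(capmx_diff Y (Rad B X)).
  by rewrite sub_capmx vD null // (submx_trans vD (diffmxSl _ _)).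
have := pos_index_ge (submx_trans (diffmxSl Y (Rad B X)) YX) nD.
rewrite -neg_indexE => le1; rewrite -rD -addnA; apply: leq_trans rY _.
rewrite leq_add2l -(mxrank_cap_compl Y (Rad B X)) addnC leq_add //.
exact/mxrankS/capmxSr.
Qed.

(** This is what turns b_U + b_W into the rank of the form on P_U S. *)
Lemma index_sum B X : B^T = B ->
  (pos_index B X + neg_index B X + \rank (Rad B X) = \rank X)%N.
Proof.
by move=> symB; apply/eqP; rewrite eqn_leq index_sum_le ?index_sum_ge.
Qed.

Lemma has_signature_rank B X p q : has_signature B X p q -> \rank X = (p + q)%N.
Proof.
move=> [P [N [[pP <-] [nN <-] _ /eqmxP <-]]].
apply: mxrank_disjoint_sum; apply: posdef_cap0 pP _ => v vN.
by have [->|v0] := eqVneq v 0; [rewrite !mul0mx mxE|exact/ltW/nN].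
Qed.

Lemma has_signature_unitmx B p q : B^T = B ->
  has_signature B 1%:M p q -> B \in unitmx.
Proof.
move=> symB [P [N [[pP _] [nN _] PN /andP[_ full]]]].
rewrite -row_free_unit; apply: inj_row_free => v vB.
have /sub_addsmxP[[x y] /=] := submx_trans (submx1 v) full.
set a := x *m P; set c := y *m N => vE.
have aP : (a <= P)%MS by exact: submxMl.
have cN : (c <= N)%MS by exact: submxMl.
have ac : (a *m B *m c^T) 0 0 = 0 by exact: perp_row PN aP cN.
have vw0 (w : 'rV_n) : (a *m B *m w^T) 0 0 + (c *m B *m w^T) 0 0 = 0.
  by move: vB; rewrite vE !mulmxDl => /(congr1 (fun M => (M *m w^T) 0 0));
     rewrite mulmxDl mul0mx !mxE.
have a0 : a = 0.
  have := vw0 a; rewrite (form_sym symB c) ac addr0 => qa.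
  by have [//|/(pP a aP)] := eqVneq a 0; rewrite qa ltxx.
have c0 : c = 0.
  have := vw0 c; rewrite ac add0r => qc.
  by have [//|/(nN c cN)] := eqVneq c 0; rewrite qc ltxx.
by rewrite vE a0 c0 addr0.
Qed.
End Indices.

(** * Dimension of the orbit and of the stabilizer *)

Lemma natr_bin2 k : ('C(k, 2))%:R = binom2 k%:R.
Proof.
elim: k => [|k IHk]; first by rewrite /binom2 bin_small // mulr0n !mul0r.
by rewrite binS bin1 natrD IHk /binom2 -natr1; field.
Qed.

Lemma mxrank_adds_le (F : fieldType) n (M N : 'M[F]_n) c d :
  (\rank M <= c)%N -> (\rank N <= d)%N -> (\rank (M + N)%MS <= c + d)%N.
Proof.
by move=> Mc Nd; apply: leq_trans (mxrank_adds_leqif _ _).1 (leq_add Mc Nd).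
Qed.

Lemma mxrankM_le (F : fieldType) n (M N : 'M[F]_n) c :
  (\rank M <= c)%N -> (\rank (M *m N) <= c)%N.
Proof. by move=> Mc; apply: leq_trans (mxrankM_maxl _ _) Mc. Qed.

Lemma rank_cap_fixpart (R : realType) n (U e S : 'M[R]_n) :
  e *m e = e -> (U == e)%MS -> \rank (S :&: U)%MS = \rank (fixpart S e).
Proof.
move=> ee eU; apply/eqmx_rank/andP; split; last first.
  have := submx_refl (fixpart S e); rewrite fixpartP => /andP[ES /eqP Ee].
  by rewrite sub_capmx ES (pi_sub eU).
by rewrite fixpartP capmxSl (sub_pi ee eU (capmxSr _ _)) eqxx.
Qed.

Section OrbitDimension.
Variables (R : realType) (n : nat) (B U W e : 'M[R]_n).
Hypothesis symB : B^T = B.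
Hypothesis uB : B \in unitmx.
Hypothesis se : selfadj_idem B e.
Hypothesis eU : (U == e)%MS.
Hypothesis eW : (W == 1%:M - e)%MS.
Local Notation e' := (1%:M - e).

Lemma adapted_parts S : S *m B *m S^T = 0 ->
  adapted B S (apart B S e) (ypart B S e) (dpart B S e) e.
Proof.
move=> isoS; split=> //.
- exact: span_radpart.
- exact: span_S.
- exact: span_Sperp.
Qed.

Lemma orbit_tangent_vspace P :
  exists L : {vspace 'M[R]_n}, forall Q, Q \in L <-> orbit_tangent B e P Q.
Proof.
apply: vspaceP_exists.
  split; first by rewrite trmx0 !(mulmx0, mul0mx) trmx0 !addr0.
  by split=> k l M N *; rewrite !(mulmx0, mul0mx) ?trmx0 ?addr0.
move=> a X Y [[X1 X2 X3] [X4 X5 X6]] [[Y1 Y2 Y3] [Y4 Y5 Y6]].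
split; split.
- by rewrite linearP /= X1 Y1.
- rewrite mulmxDl mulmxDr -scalemxAl -scalemxAr addrACA -scalerDr X2 Y2 //.
- rewrite mulmxDr !mulmxDl -scalemxAr -!scalemxAl linearP /= addrACA -scalerDr.
  by rewrite X3 Y3 scaler0 addr0.
- move=> k l M N MP Me NB Ne; rewrite mulmxDr !mulmxDl -scalemxAr -!scalemxAl.
  by rewrite X4 // Y4 // scaler0 addr0.
- move=> k l M N MP Me NB Ne; rewrite mulmxDr !mulmxDl -scalemxAr -!scalemxAl.
  by rewrite X5 // Y5 // scaler0 addr0.
- move=> k l M N MP NP MB NB; rewrite !mulmxDr !mulmxDl -!scalemxAr -!scalemxAl.
  by rewrite linearP /= addrACA -scalerDr X6 // Y6 // scaler0 addr0.
Qed.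

Section Numbers.
Variables u w r rU rW a b : nat.
Hypothesis rank_e : \rank e = u.
Hypothesis rank_e' : \rank e' = w.

(** The 5-tuple expressed by ranks that are constant along the orbit, in additive form to avoid
    truncated subtraction; [a] enters through [r_eq]. *)
Definition orbit_type (S : 'M[R]_n) :=
  [/\ S *m B *m S^T = 0, \rank S = r, (\rank (S *m e') + rU = r)%N,
      (\rank (S *m e) + rW = r)%N & \rank (S *m (e *m B) *m S^T) = b].
Hypothesis r_eq : r = (rU + rW + a + b)%N.

Lemma rank_e_sum : (u + w = n)%N.
Proof.
rewrite -rank_e -rank_e' -mxrank_disjoint_sum.
  apply/eqP; rewrite eqn_leq rank_leq_col -{1}(mxrank1 R n) mxrankS //.
  by rewrite -{1}(subrK e 1%:M) addrC addmx_sub_adds.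
apply/eqP; rewrite -submx0; apply/rV_subP => v; rewrite sub_capmx.
rewrite (sub_idem _ se) (sub_idem _ (selfadj_idemC se)) mulmxBr mulmx1.
by move=> /andP[/eqP ->]; rewrite subrr eq_sym submx0.
Qed.

(** The rank identities of the adapted parts form a linear system with this unique solution. As the
    form suggests, [fpart] has the dimension of [fixpart] and [dpart] that of [apart]. *)
Lemma rank_table S : orbit_type S ->
  [/\ \rank (fixpart S e) = rU, \rank (fixpart S e') = rW,
      \rank (apart B S e) = a, \rank (ypart B S e) = b &
      \rank (dpart B S e) = a] /\
  [/\ \rank (fpart B S e) = rU, \rank (fpart B S e') = rW,
      (\rank (zpart B S e) + 2 * (rU + a) + b = u)%N &
      (\rank (zpart B S e') + 2 * (rW + a) + b = w)%N].
Proof.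
move=> [isoS rS rSe' rSe rG]; have se' := selfadj_idemC se.
have n_eq := rank_e_sum.
have h1 := rank_fixpart S e; have h2 := rank_fixpart S e'; rewrite idemC_id in h2.
have h3 := rank_radpart B S e; have h4 := rank_ypart B S e.
have h5 := rank_apart isoS se; have h6 := rank_perppart S uB se.
have h7 := rank_perppart S uB se'; have h8 := rank_radpartM B S e.
have h9 := rank_radpartM B S e'; rewrite idemC_id in h9.
have h10 := rank_zpart S se; have h11 := rank_zpart S se'.
have h12 := rank_perp_sum isoS se; have h13 := rank_dpart isoS e.
have h14 := rank_Sperp S uB; have h15 := rank_fpart B S e.
have h16 := rank_fpart B S e'; have h17 := rank_SperpM S se.
have h18 := rank_SperpM S se'; rewrite idemC_id in h18.
have h19 : \rank (radpart B S e') = \rank (radpart B S e).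
  by rewrite (radpartC isoS).
by clear eU eW; split; split; lia.
Qed.

(** The bound of [stab_dim_le] after [rank_table], with [m] and [m'] the ranks of the two [zpart]s.
    Its nesting and its final 0 copy that bound, so that the two are compared term by term. *)
Definition stab_dim m m' : nat :=
  (rU * (rU + a + b + m) + (a * (a + b + m) + ('C(b, 2) + ('C(m, 2) +
   ('C(a + rU, 2) + (rW * (rW + a + b + m') + (a * m' + ('C(m', 2) +
   ('C(a + rW, 2) + 0)))))))))%N.

Definition orbit_dim m m' : nat :=
  ('C(rU, 2) + (rU * (a + b + m + a) + ('C(rW, 2) + (rW * (a + b + m' + a) +
   ('C(a, 2) + ('C(a, 2) + (a * (b + m + m' + a) +
   ('C(b, 2) + (b * (a + m + m' + a) + 0)))))))))%N.

(** Over the rationals the binomials are polynomials, and the identity that closes the chain of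
    inequalities becomes a polynomial one. *)
Lemma orbit_dim_add m m' :
  (m + 2 * (rU + a) + b = u)%N -> (m' + 2 * (rW + a) + b = w)%N ->
  (stab_dim m m' + orbit_dim m m' = 'C(u, 2) + 'C(w, 2))%N.
Proof.
move=> <- <-; apply/eqP; rewrite -(@eqr_nat rat) /stab_dim /orbit_dim.
rewrite !(natrD, natrM) !natr_bin2 /binom2 !(natrD, natrM); apply/eqP.
by field.
Qed.

Lemma Hstab_dim_le S (L : {vspace 'M[R]_n}) m m' : orbit_type S ->
  (m + 2 * (rU + a) + b = u)%N -> (m' + 2 * (rW + a) + b = w)%N ->
  (forall X, X \in L <-> stab_algebra B U W S X) ->
  (\dim L <= stab_dim m m')%N.
Proof.
move=> tS mu mw LP; have [isoS _ _ _ _] := tS.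
have [[rE rE' rA rY rD] [rF rF' rZ rZ']] := rank_table tS.
have {}rZ : \rank (zpart B S e) = m by lia.
have {}rZ' : \rank (zpart B S e') = m' by lia.
have bd := stab_dim_le symB uB isoS (adapted_parts isoS).
apply: leq_trans (bd L _) _ => [X /LP[XB UX WX SX]|].
  by split=> //; apply: (stable_pi (proj1 se) eU eW).
rewrite /stab_dim.
repeat first [apply: leq_add | apply: leq_mul | apply: leq_bin2l | 
  apply: mxrank_adds_le | apply: mxrankM_le];
  rewrite ?rE ?rE' ?rA ?rY ?rD ?rF ?rF' ?rZ ?rZ' //.
Qed.

Lemma Horbit_dim_le S m m' : orbit_type S ->
  (m + 2 * (rU + a) + b = u)%N -> (m' + 2 * (rW + a) + b = w)%N ->
  (real_dim (Horbit B U W r S) <= orbit_dim m m')%N.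
Proof.
move=> tS mu mw; have [isoS rS rSe' rSe rG] := tS.
apply: real_dim_le => d; apply: C1_piece_dim_le => f df v fv Of.
have [L LP] := orbit_tangent_vspace (f v).
exists L, 1%:M; split; first exact: unitmx1.
  move=> x; rewrite mulmx1; apply/LP.
  exact: (Horbit_tangent symB (proj1 se) eU eW (proj2 se) x isoS fv Of).
have [[[Psym [PP _]] _] [rP rPe rPe' rPG /(_ isoS) isoP]] :=
  (nbhs_singleton Of, Horbit_ranks (proj1 se) eU eW (nbhs_singleton Of)).
move: (f v) Psym PP rP rPe rPe' rPG isoP LP => P Psym PP rP rPe rPe' rPG isoP LP.
(* The point [P] of the piece lies on the orbit, so the parts adapted to [P] have the same
   dimensions as those adapted to [S]. *)
have tP : orbit_type P by split; rewrite ?rP ?rPe ?rPe' ?rPG.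
have [[rE rE' rA rY rD] [rF rF' rZ rZ']] := rank_table tP.
have {}rZ : \rank (zpart B P e) = m by lia.
have {}rZ' : \rank (zpart B P e') = m' by lia.
have bd := tangent_dim_le symB uB isoP Psym PP (adapted_parts isoP).
apply: leq_trans (bd L _) _ => [X /LP //|].
rewrite /orbit_dim.
repeat first [apply: leq_add | apply: leq_mul | apply: leq_bin2l | 
  apply: mxrank_adds_le | apply: mxrankM_le];
  rewrite ?rE ?rE' ?rA ?rY ?rD ?rF ?rF' ?rZ ?rZ' //.
Qed.

Lemma Hgroup_Hstab0 : Hgroup B U W = Hstab B U W 0.
Proof.
apply/predeqP => h; split=> [Hh|[]//].
by split=> //; rewrite mul0mx submx_refl.
Qed.

Lemma orbit_type_dims S m m' : orbit_type S ->
  (m + 2 * (rU + a) + b = u)%N -> (m' + 2 * (rW + a) + b = w)%N ->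
  [/\ real_dim (Hgroup B U W) = ('C(u, 2) + 'C(w, 2))%N,
      real_dim (Hstab B U W S) = stab_dim m m' &
      real_dim (Horbit B U W r S) = orbit_dim m m'].
Proof.
move=> tS mu mw; have [_ rS _ _ _] := tS.
have [L LP] := stab_algebra_vspace B U W 0.
have [LS LSP] := stab_algebra_vspace B U W S.
rewrite Hgroup_Hstab0 (real_dim_Hstab uB LP) (real_dim_Hstab uB LSP).
(* A lower bound on dim h is enough: equality results from the chain, together with the other two
   dimensions. *)
have h1 : ('C(u, 2) + 'C(w, 2) <= \dim L)%N.
  rewrite -rank_e -rank_e'; apply: (isometry_algebra_dim_ge symB uB se) => X XB eX.
  have [UX WX] := pi_stable (proj1 se) eU eW eX.
  by apply/LP; split=> //; rewrite mul0mx sub0mx.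
have h2 := dimvS (stab_algebra_sub LP LSP).
have h3 := Hstab_dim_le tS mu mw LSP.
have h4 := real_dim_orbit_ge uB LP LSP; rewrite rS in h4.
have h5 := Horbit_dim_le tS mu mw.
have h6 := orbit_dim_add mu mw.
by split; lia.
Qed.

End Numbers.

Lemma projUE S : (projU U W S :=: S *m e)%MS.
Proof.
apply/eqmxP/andP; split.
  set X := projU _ _ _.
  have XU : (X <= U)%MS by exact: capmxSr.
  have Xe := sub_pi (proj1 se) eU XU.
  have /sub_addsmxP[[x y] /= XE] : (X <= S + W)%MS by exact: capmxSl.
  rewrite -Xe XE mulmxDl -!mulmxA (sub_pi' (proj1 se) eW (submx_refl W)).
  by rewrite mulmx0 addr0 submxMl.
have -> : S *m e = S - S *m e' by rewrite mulmxBr mulmx1 opprB addrC subrK.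
rewrite sub_capmx; apply/andP; split.
  by apply: addmx_sub_adds => //; rewrite eqmx_opp (eqmxP eW) submxMl.
rewrite mulmxBr mulmx1 opprB addrC subrK; apply: (pi_sub eU).
by rewrite -mulmxA (proj1 se).
Qed.

Lemma invariants_orbit_type (S : 'M[R]_n) (r rU rW a bU bW : nat) :
  S *m B *m S^T = 0 -> \rank S = r ->
  invariants B U W S = (rU, rW, a, bU, bW) ->
  r = (rU + rW + a + (bU + bW))%N /\ orbit_type r rU rW (bU + bW) S.
Proof.
move=> isoS rS [rUE rWE aE bUE bWE].
have rB := index_sum (projU U W S) symB; rewrite bUE bWE in rB.
have rkX : \rank (projU U W S) = \rank (S *m e) by rewrite projUE.
have rR : (\rank (S *m e *m B *m (S *m e)^T) + \rank (Rad B (projU U W S)) =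
           \rank (projU U W S))%N.
  rewrite -(eqmx_mxrank_gram B (projUE S)) -(mulmxA (projU U W S)).
  exact: mxrank_mul_ker.
move: rR; have -> : S *m e *m B *m (S *m e)^T = S *m (e *m B) *m S^T.
  rewrite trmx_mul !mulmxA -(mulmxA _ B) -(proj2 se) mulmxA.
  by rewrite -(mulmxA S e e) (proj1 se).
move=> rR; have h1 := rank_fixpart S e.
have h2 := rank_fixpart S (1%:M - e); rewrite idemC_id in h2.
(* These two identities give r_U + r_W + b <= r, so the subtraction in the third entry of
   [invariants] is not truncated. *)
have h3 := rank_radpart B S e; have h4 := rank_apart isoS se.
have fU := rank_cap_fixpart S (proj1 se) eU.
have fW := rank_cap_fixpart S (proj1 (selfadj_idemC se)) eW.
by clear uB eU eW; split; [lia|split=> //; lia].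
Qed.
End OrbitDimension.

(** Orthogonality of U and W kills e B (1 - e)^T and its transpose, so e B and B e^T both equal e B
    e^T. *)
Lemma decomposition_idempotent (R : realType) n (B U W : 'M[R]_n) :
  B^T = B -> mxdirect (U + W)%MS -> (U + W == 1%:M)%MS -> perp B U W ->
  exists e, [/\ selfadj_idem B e, (U == e)%MS & (W == 1%:M - e)%MS].
Proof.
move=> symB /mxdirect_addsP UW0 /andP[_ full] UW; pose e := proj_mx U W.
have eU : (e <= U)%MS by rewrite -[e]mul1mx proj_mx_sub.
have ee : e *m e = e by exact: proj_mx_id.
have e'E : 1%:M - e = proj_mx W U.
  by have := add_proj_mx UW0 full; rewrite !mul1mx => <-; rewrite addrC addKr.
have Ue : U *m e = U by exact: proj_mx_id.
have We : W *m (1%:M - e) = W by rewrite e'E; apply: proj_mx_id => //; rewrite capmxC.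
clearbody e.
have eW : (1%:M - e <= W)%MS by rewrite e'E -[X in (X <= _)%MS]mul1mx proj_mx_sub.
have eBe' : e *m B *m (1%:M - e)^T = 0.
  by apply/eqP; apply: mxortho_sub eU eW _; apply/eqP.
have e'Be : (1%:M - e) *m B *m e^T = 0.
  by apply: trmx_inj; rewrite trmx0 !trmx_mul trmxK symB mulmxA eBe'.
exists e; split.
- split=> //.
  have <- : e *m B *m e^T = e *m B.
    by apply/subr0_eq; rewrite -oppr0 -eBe' raddfB /= trmx1 mulmxBr mulmx1 opprB.
  by apply/esym/subr0_eq; rewrite -e'Be !mulmxBl mul1mx.
- by rewrite eU andbT -{1}Ue submxMl.
- by rewrite eW andbT -{1}We submxMl.
Qed.

Theorem theorem5p7 (R : realType) (p q p1 q1 r rU rW a bU bW : nat)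
    (B U W S : 'M[R]_(p + q)) (O : set 'M[R]_(p + q))
    (hp1 : (0 < p1 < p)%N) (hq1 : (0 < q1 < q)%N) (hr : (r <= minn p q)%N)
    (hB : B^T = B) (hV : has_signature B 1%:M p q)
    (hUW : mxdirect (U + W)%MS) (hUWV : (U + W == 1%:M)%MS)
    (hperp : perp B U W)
    (hU : has_signature B U p1 q1)
    (hW : has_signature B W (p - p1) (q - q1))
    (hO : Horbit_of_type B U W r (rU, rW, a, bU, bW) O) (hS : O S) :
  let dimO : rat := (real_dim O)%:R in
  let dimH : rat := (real_dim (Hgroup B U W))%:R in
  let dimHS : rat := (real_dim (Hstab B U W S))%:R in
  let u : rat := (p1 + q1)%:R in
  let w : rat := p%:R + q%:R - p1%:R - q1%:R in
  let b : rat := (bU + bW)%:R in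
  [/\ dimO = dimH - dimHS,
      dimH - dimHS =
        binom2 u + binom2 (p%:R - p1%:R + q%:R - q1%:R) - dimHS &
      dimHS =
        1 / 2 * binom2 u + 1 / 2 * binom2 w + (rU%:R ^+ 2 + rW%:R ^+ 2) / 2
        + binom2 b - a%:R * b
        - 1 / 2 * binom2 (u - 2 * rU%:R - 2 * a%:R)
        - 1 / 2 * binom2 (w - 2 * rW%:R - 2 * a%:R)
        + binom2 (u - 2 * rU%:R - 2 * a%:R - b)
        + binom2 (w - 2 * rW%:R - 2 * a%:R - b)].
Proof.
have uB := has_signature_unitmx hB hV.
have [e [se eU eW]] := decomposition_idempotent hB hUW hUWV hperp.
have rke : \rank e = (p1 + q1)%N.
  by rewrite -(has_signature_rank hU); apply/esym/eqmx_rank.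
have rke' : \rank (1%:M - e) = (p - p1 + (q - q1))%N.
  by rewrite -(has_signature_rank hW); apply/esym/eqmx_rank.
have [S0 [[[_ [_ rS0]] isoS0] tS0 OE]] := hO; move: hS; rewrite OE => SO.
have [r_eq type0] := invariants_orbit_type hB se eU eW isoS0 rS0 tS0.
have [isoS0' rk0 rke0' rke0 rkG0] := type0.
have [rS rSe rSe' rSG /(_ isoS0) isoS] := Horbit_ranks (proj1 se) eU eW SO.
have type : orbit_type B e r rU rW (bU + bW) S.
  by split; rewrite ?rS ?rSe ?rSe' ?rSG.
have [_ [_ _ mu mw]] := rank_table uB se rke rke' r_eq type.
(* The dimension of [O] comes from the base point [S0] that defines it, those of H and of the
   stabilizer from the given point [S] of the orbit. *)
have [_ _ ->] := orbit_type_dims hB uB se eU eW rke rke' r_eq type0 mu mw.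
have [-> -> _] := orbit_type_dims hB uB se eU eW rke rke' r_eq type mu mw.
have add := orbit_dim_add mu mw.
move: (\rank (zpart B S e)) (\rank (zpart B S (1%:M - e))) mu mw add.
move=> m m' mu mw add.
move=> dimO dimH dimHS u w b.
(* The truncated subtractions are exact because p1 < p and q1 < q. *)
have wE : w = (p - p1 + (q - q1))%:R.
  have /andP[_ /ltnW p1p] := hp1; have /andP[_ /ltnW q1q] := hq1.
  by rewrite natrD !natrB // /w; ring.
have addR : dimH = dimHS + dimO by rewrite /dimHS /dimO -natrD add.
have dimHE : dimH = binom2 u + binom2 w by rewrite wE /dimH natrD !natr_bin2.
have uE : u = m%:R + 2 * (rU%:R + a%:R) + b.
  by rewrite /u -mu /b natrD (natrD _ m) natrM (natrD _ rU).
have {}wE : w = m'%:R + 2 * (rW%:R + a%:R) + b.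
  by rewrite wE -mw /b natrD (natrD _ m') natrM (natrD _ rW).
have -> : p%:R - p1%:R + q%:R - q1%:R = w by rewrite /w; ring.
split; first by rewrite addR addrC addKr.
  by rewrite dimHE.
rewrite uE wE /dimHS /stab_dim !(natrD, natrM) !natr_bin2 -[bU%:R + bW%:R]natrD -/b.
by rewrite /binom2; field.
Qed.
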